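(* Let $d\ge 1$ be an integer and let $0<\omega<1$. Then there exists a nontrivial positive (real-valued) solution $u=u(r)$, $r\in\,]0,\infty[$, of the problem $$-u''-\frac{d-1}{r}u'+\omega u=\frac{u^3}{1+u^2},\qquad u\in H^2(]0,\infty[),\qquad u'(0)=0.$$
   Context: This ODE problem is the equation for real radial solutions $U(\mathbf{x})=u(|\mathbf{x}|)$ of $-\Delta U+\omega U=\frac{|U|^2U}{1+|U|^2}$ on $\mathbb{R}^d$, i.e. for radial profiles of solitary waves $e^{i\omega t}U(\mathbf{x})$ of the saturated nonlinear Schrödinger equation $i\partial_tA+\Delta A=-a\frac{|A|^2A}{1+|A|^2}$ in the focusing case $a=1$. *)

(* Defs.v *)
From mathcomp Require Import all_boot all_order all_algebra.
From mathcomp Require Import all_classical all_reals all_analysis.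
Import Order.TTheory GRing.Theory Num.Theory.
Import numFieldNormedType.Exports.

Set Implicit Arguments.
Unset Strict Implicit.
Unset Printing Implicit Defensive.

Local Open Scope classical_set_scope.
Local Open Scope ring_scope.

(* A function on an open subset D of the line is represented by a total
   function R -> R; the notions below only depend on its values on D. *)

Definition in_L2 (R : realType) (D : set R) (f : R -> R) : Prop :=
  f \_ D \in Lfun (@lebesgue_measure R) 2%:E.

(* Smooth functions with compact support included in D. *)
Definition test_function (R : realType) (D : set R) (phi : R -> R) : Prop :=
  (forall (n : nat) (x : R), derivable (phi^`(n))%classic x 1) /\
  (exists2 K : set R, compact K /\ K `<=` D & forall x, ~ K x -> phi x = 0).

(* Meaningful for f and g locally integrable on D, since otherwise Rintegral
   may take a default value; in in_H2 all the functions involved are in L^2. *)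
Definition weak_derivative (R : realType) (D : set R) (f g : R -> R) : Prop :=
  forall phi : R -> R, test_function D phi ->
    \int[@lebesgue_measure R]_(x in D) (f x * phi^`()%classic x) =
    - \int[@lebesgue_measure R]_(x in D) (g x * phi x).

Definition in_H2 (R : realType) (D : set R) (u : R -> R) : Prop :=
  exists u1 u2 : R -> R,
    [/\ in_L2 D u, in_L2 D u1, in_L2 D u2,
        weak_derivative D u u1 & weak_derivative D u1 u2].

(* The half-line is open, so the derivatives at r > 0 do not see the values of
   u on ]-oo, 0]. The boundary condition u'(0) = 0 is the vanishing of the trace
   of u' at 0, that is, of its limit at 0 from the right. *)
Definition radial_saturated_nls_solution (R : realType) (d : nat) (omega : R)
    (u : R -> R) : Prop :=
  [/\ forall r : R, 0 < r ->
        derivable u r 1 /\ derivable u^`()%classic r 1,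
      forall r : R, 0 < r ->
        - u^`(2)%classic r - (d%:R - 1) / r * u^`()%classic r + omega * u r
          = u r ^+ 3 / (1 + u r ^+ 2),
      in_H2 `]0, +oo[ u &
      u^`()%classic r @[r --> 0^'+] --> (0 : R)].

(* Main.v *)
(* Shooting.  Put m = d - 1, k = 1 - omega and g(s) = k s - s/(1+s^2), so that
   the equation reads u'' + (m/r) u' = -g(u).  For every a there is a global
   solution u_a with u_a(0) = a and u_a'(0) = 0, Lipschitz in a: with
   p = - u', the Picard iteration for r^m p = int_0^r s^m g(u), u = a - int_0^r p
   contracts for the weight exp(-2r), since g is globally 2-Lipschitz.  The
   energy E = p^2/2 + G(u), with G' = g and G(0) = 0, is nonincreasing.
     Let a be the infimum of the heights b > 0 whose solution becomes negative.
   There are such heights, because g is asymptotically linear and the limit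
   problem v'' + (m/r) v' + k v = 0 oscillates; and they are bounded away from 0,
   since G < 0 near 0.  As the set is open, u_a >= 0, hence u_a > 0 by
   uniqueness.  Moreover E >= 0 along u_a: if E became negative, the same would
   happen for nearby heights, which would then be trapped away from 0, whereas
   some of them cross 0.
     E >= 0 forces p > 0 (a first zero of p would have G(u) >= 0, hence
   g(u) > 0), and p^2 >= -2 G(u) >= c^2 u^2 as soon as u is small enough, which
   must happen eventually.  Thus u <= p/c at infinity, and since p is bounded
   and integrable (its integral is at most a), u, u' and u'' are in L^2. *)
Require Import Defs.
From mathcomp Require Import all_boot all_order all_algebra.
From mathcomp Require Import all_classical all_reals all_analysis.
From mathcomp Require Import measurable_realfun ring lra.
Import Order.TTheory GRing.Theory Num.Theory.
Import numFieldNormedType.Exports.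

Set Implicit Arguments.
Unset Strict Implicit.
Unset Printing Implicit Defensive.

Local Open Scope classical_set_scope.
Local Open Scope ring_scope.

(** * Calculus on the line *)

Section pointwise_rules.
Context {R : realType}.
Implicit Types (f g : R -> R) (a b c x : R).

Lemma is_derive_cstE c x : is_derive x 1 (fun=> c) 0.
Proof. exact: is_derive_cst. Qed.

Lemma is_derive_idE x : is_derive x 1 (fun y : R => y) 1.
Proof. exact: is_derive_id. Qed.

Lemma is_derive_add f g x a b : is_derive x 1 f a -> is_derive x 1 g b ->
  is_derive x 1 (fun y => f y + g y) (a + b).
Proof. exact: is_deriveD. Qed.

Lemma is_derive_opp f x a : is_derive x 1 f a ->
  is_derive x 1 (fun y => - f y) (- a).
Proof. exact: is_deriveN. Qed.

Lemma is_derive_mul f g x a b : is_derive x 1 f a -> is_derive x 1 g b ->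
  is_derive x 1 (fun y => f y * g y) (f x * b + g x * a).
Proof. exact: is_deriveM. Qed.

Lemma is_derive_exprn f n x a : is_derive x 1 f a ->
  is_derive x 1 (fun y => f y ^+ n) (n%:R * f x ^+ n.-1 * a).
Proof.
move=> fa; have -> : (fun y => f y ^+ n) = f ^+ n.
  by apply/funext => y; rewrite exprfctE.
exact: is_deriveX.
Qed.

Lemma is_derive_inv f x a : f x != 0 -> is_derive x 1 f a ->
  is_derive x 1 (fun y => (f y)^-1) (- (f x ^- 2) * a).
Proof. by move=> fx0 fa; apply: is_deriveV. Qed.

Lemma is_derive_expR_comp f x a : is_derive x 1 f a ->
  is_derive x 1 (fun y => expR (f y)) (expR (f x) * a).
Proof.
by move=> fa; exact: is_derive1_comp.
Qed.

Lemma is_derive_ln_comp f x a : 0 < f x -> is_derive x 1 f a ->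
  is_derive x 1 (fun y => ln (f y)) ((f x)^-1 * a).
Proof.
move=> fx0 fa; have := is_derive1_ln fx0 => ?.
exact: is_derive1_comp.
Qed.

Lemma is_derive_continuous f x a : is_derive x 1 f a -> {for x, continuous f}.
Proof.
by move=> fa; apply: differentiable_continuous; apply/derivable1_diffP; case: fa.
Qed.

Lemma is_derive_near f g x a : (\forall y \near x, f y = g y) ->
  is_derive x 1 f a -> is_derive x 1 g a.
Proof.
by move=> fg; apply: near_eq_is_derive. Qed.

End pointwise_rules.

(* is_derive is a type class: plain apply would let instance resolution choose
   derivatives written with scalar multiplication, which ring cannot read. *)
Ltac deriv :=
  try eassumption;
  lazymatch goal with
  | |- is_derive _ _ (fun _ => ?c) _ => notypeclasses refine (is_derive_cstE _ _)
  | |- is_derive _ _ (fun y => y) _ => notypeclasses refine (is_derive_idE _)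
  | |- is_derive _ _ (fun y => @?f y + @?g y) _ =>
      notypeclasses refine (is_derive_add _ _); deriv
  | |- is_derive _ _ (GRing.mul _) _ =>
      notypeclasses refine (is_derive_mul (is_derive_cstE _ _) (is_derive_idE _))
  | |- is_derive _ _ GRing.opp _ =>
      notypeclasses refine (is_derive_opp (is_derive_idE _))
  | |- is_derive _ _ (fun y => - @?f y) _ =>
      notypeclasses refine (is_derive_opp _); deriv
  | |- is_derive _ _ (fun y => @?f y * @?g y) _ =>
      notypeclasses refine (is_derive_mul _ _); deriv
  | |- is_derive _ _ (fun y => @?f y ^+ _) _ =>
      notypeclasses refine (is_derive_exprn _ _); deriv
  | |- is_derive _ _ (fun y => (@?f y)^-1) _ =>
      notypeclasses refine (is_derive_inv _ _); deriv
  | |- is_derive _ _ (fun y => expR (@?f y)) _ =>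
      notypeclasses refine (is_derive_expR_comp _); deriv
  | |- is_derive _ _ (fun y => ln (@?f y)) _ =>
      notypeclasses refine (is_derive_ln_comp _ _); deriv
  | _ => idtac
  end.

Ltac deriv_eq := notypeclasses refine (is_derive_eq _ _); [deriv | rewrite /=].

Section continuity_rules.
Context {R : realType}.
Implicit Types (f g : R -> R) (c : R).

Lemma continuous_cst c : continuous (fun _ : R => c).
Proof. by move=> x; exact: cvg_cst. Qed.

Lemma continuous_idE : continuous (fun x : R => x).
Proof. by move=> x; exact: cvg_id. Qed.

Lemma continuous_add f g : continuous f -> continuous g ->
  continuous (fun x => f x + g x).
Proof. by move=> cf cg x; apply: cvgD; [exact: cf|exact: cg]. Qed.

Lemma continuous_opp f : continuous f -> continuous (fun x => - f x).
Proof. by move=> cf x; apply: cvgN; exact: cf. Qed.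

Lemma continuous_mul f g : continuous f -> continuous g ->
  continuous (fun x => f x * g x).
Proof. by move=> cf cg x; apply: cvgM; [exact: cf|exact: cg]. Qed.

Lemma continuous_exprn f n : continuous f -> continuous (fun x => f x ^+ n).
Proof.
move=> cf x.
apply: (continuous_comp (g := fun y : R => y ^+ n)); first exact: cf.
exact: exprn_continuous.
Qed.

Lemma continuous_expR_comp f : continuous f -> continuous (fun x => expR (f x)).
Proof.
move=> cf x.
by apply: (continuous_comp (g := @expR R)); [exact: cf|exact: continuous_expR].
Qed.

Lemma continuous_inv f : continuous f -> (forall x, f x != 0) ->
  continuous (fun x => (f x)^-1).
Proof. by move=> cf f0 x; apply: cvgV; [exact: f0|exact: cf]. Qed.

Lemma continuous_ln_comp f : continuous f -> (forall x, 0 < f x) ->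
  continuous (fun x => ln (f x)).
Proof.
move=> cf f0 x.
by apply: (continuous_comp (g := @ln R)); [exact: cf|exact: continuous_ln].
Qed.

End continuity_rules.

(* The patterns GRing.mul _ and GRing.opp are eta-contracted functions, into which
   the matching of a product or of an opposite may turn its arguments. *)
Ltac cont :=
  lazymatch goal with
  | |- forall x, continuous_at x (fun _ => ?c) => exact: continuous_cst
  | |- forall x, continuous_at x (fun y => y) => exact: continuous_idE
  | |- forall x, continuous_at x (fun y => @?f y + @?g y) =>
      refine (continuous_add _ _); cont
  | |- forall x, continuous_at x (GRing.mul _) =>
      refine (continuous_mul (@continuous_cst _ _) (@continuous_idE _))
  | |- forall x, continuous_at x GRing.opp =>
      refine (continuous_opp (@continuous_idE _))
  | |- forall x, continuous_at x (fun y => - @?f y) =>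
      refine (continuous_opp _); cont
  | |- forall x, continuous_at x (fun y => @?f y * @?g y) =>
      refine (continuous_mul _ _); cont
  | |- forall x, continuous_at x (fun y => @?f y ^+ _) =>
      refine (continuous_exprn _); cont
  | |- forall x, continuous_at x (fun y => (@?f y)^-1) =>
      refine (continuous_inv _ _); cont
  | |- forall x, continuous_at x (fun y => expR (@?f y)) =>
      refine (continuous_expR_comp _); cont
  | |- forall x, continuous_at x (fun y => ln (@?f y)) =>
      refine (continuous_ln_comp _ _); cont
  | _ => try assumption
  end.

(** * Comparison of increments by the mean value theorem *)

Section comparison.
Context {R : realType}.
Implicit Types (f g : R -> R) (a b x : R).

(** The derivative is only asked for inside the interval, so that the endpoint 0, where the radial
    functions below are only shown to be continuous, is allowed. *)
Lemma is_derive_le f f' a b : a <= b -> continuous f ->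
  (forall x, a < x < b -> is_derive x 1 f (f' x)) ->
  (forall x, a < x < b -> 0 <= f' x) -> f a <= f b.
Proof.
rewrite le_eqVlt => /predU1P[->//|ab] cf df f'0.
have [c] := @MVT R f f' a b ab (fun x xab => df x xab) (continuous_subspaceT cf).
move=> cab; rewrite -subr_ge0 => ->.
by rewrite mulr_ge0 ?f'0// subr_ge0 ltW.
Qed.

Lemma is_derive_le_sub f f' g g' a b : a <= b -> continuous f -> continuous g ->
  (forall x, a < x < b -> is_derive x 1 f (f' x)) ->
  (forall x, a < x < b -> is_derive x 1 g (g' x)) ->
  (forall x, a < x < b -> f' x <= g' x) -> f b - f a <= g b - g a.
Proof.
move=> ab cf cg df dg fg.
have := @is_derive_le (fun x => g x - f x) (fun x => g' x - f' x) a b ab.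
have h : forall x, a < x < b -> 0 <= g' x - f' x.
  by move=> x xab; rewrite subr_ge0 fg.
have dgf x : a < x < b -> is_derive x 1 (fun x => g x - f x) (g' x - f' x).
  by move=> xab; apply: is_derive_add; [exact: dg|apply: is_derive_opp; exact: df].
have cgf : continuous (fun x => g x - f x) by cont.
by move=> /(_ cgf dgf h); lra.
Qed.

Lemma is_derive_norm_le_sub f f' g g' a b : a <= b ->
  continuous f -> continuous g ->
  (forall x, a < x < b -> is_derive x 1 f (f' x)) ->
  (forall x, a < x < b -> is_derive x 1 g (g' x)) ->
  (forall x, a < x < b -> `|f' x| <= g' x) -> `|f b - f a| <= g b - g a.
Proof.
move=> ab cf cg df dg fg; rewrite ler_norml; apply/andP; split.
  have : - g b - - g a <= f b - f a; last lra.
  apply: (@is_derive_le_sub (fun x => - g x) (fun x => - g' x) f f') => //.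
  - by cont.
  - by move=> x xab; apply: is_derive_opp; exact: dg.
  - by move=> x xab; have := fg _ xab; rewrite ler_norml => /andP[].
apply: (@is_derive_le_sub f f' g g') => // x xab.
exact: le_trans (ler_norm _) (fg _ xab).
Qed.

Lemma continuous_bounded f a b :
  continuous f -> exists M, 0 < M /\ forall x, a <= x <= b -> `|f x| <= M.
Proof.
move=> cf; have [ab|ba] := leP a b; last first.
  by exists 1; split=> // x /andP[ax /(le_trans ax)]; rewrite leNgt ba.
have cnf : continuous (fun x => `|f x|).
  by move=> x; apply: cvg_norm; exact: cf.
have [c _ fc] := EVT_max ab (continuous_subspaceT cnf).
exists (`|f c| + 1); split=> [|x xab]; first by rewrite ltr_wpDl.
by rewrite (le_trans (fc x xab))// lerDl.
Qed.

Lemma continuous_pos_min f a b : a <= b -> continuous f ->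
  (forall x, a <= x <= b -> 0 < f x) ->
  exists M, 0 < M /\ forall x, a <= x <= b -> M <= f x.
Proof.
move=> ab cf f0.
have [c cab fc] := EVT_min ab (continuous_subspaceT cf).
by exists (f c); split; [exact: f0|exact: fc].
Qed.

End comparison.

(** * Primitives from 0 *)

Section primitive.
Context {R : realType}.
Notation mu := (@lebesgue_measure R).
Implicit Types (f : R -> R) (a b x : R).

(* The interval is empty for x < 0, so that prim f vanishes there; this lets all
   the radial functions below be continuous on the whole line. *)
Definition prim f x : R := \int[mu]_(t in `[0, x]) f t.

Lemma continuous_itv_integrable f a b : continuous f ->
  mu.-integrable `[a, b] (EFin \o f).
Proof.
move=> cf; apply: continuous_compact_integrable; first exact: segment_compact.
exact: continuous_subspaceT.
Qed.

Lemma prim_le0 f x : x <= 0 -> prim f x = 0.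
Proof.
rewrite /prim le_eqVlt => /predU1P[->|x0]; first by rewrite set_itv1 Rintegral_set1.
by rewrite set_itv_ge ?Rintegral_set0// bnd_simp -ltNge.
Qed.

Lemma is_derive_prim f x : continuous f -> 0 < x -> is_derive x 1 (prim f) (f x).
Proof.
move=> cf x0.
have xx1 : x < x + 1 by rewrite ltrDl.
have fi := @continuous_itv_integrable f 0 (x + 1) cf.
have [dF F'] := continuous_FTC1_closed xx1 fi x0 (cf x).
by rewrite derive1E in F'; exact: DeriveDef dF F'.
Qed.

Lemma prim_continuous f : continuous f -> continuous (prim f).
Proof.
move=> cf x; have [x0|x0|->] := ltgtP x 0.
- apply: (@is_derive_continuous _ _ _ 0).
  have : \forall y \near x, 0 = prim f y.
    by near=> y; rewrite prim_le0//; apply/ltW; near: y; exact: lt_nbhsl.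
  by move/(@is_derive_near _ (fun=> 0)); apply; exact: is_derive_cstE.
- exact: is_derive_continuous (is_derive_prim cf x0).
- have := @parameterized_integral_cvg_left R 0 1 f ltr01
    (@continuous_itv_integrable f 0 1 cf).
  by rewrite /continuous_at [X in _ -> _ --> X]prim_le0.
Unshelve. all: by end_near. Qed.

End primitive.

(** * The radial integral operator *)

Section radial_operator.
Context {R : realType} (m : nat).
Implicit Types (h : R -> R) (b r C M : R).

Definition flux h r : R := prim (fun s => s ^+ m * h s) r.

Definition slope h r : R := flux h r / r ^+ m.

(** For continuous [h] this inverts the radial Laplacian: w = [pot h] satisfies w'' + (m/r) w' = h
    for r > 0, with w(0) = 0, and w' = [slope h] tends to 0 at 0. *)
Definition pot h r : R := prim (slope h) r.

Lemma continuous_flux h : continuous h -> continuous (flux h).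
Proof. by move=> ch; apply: prim_continuous; cont. Qed.

Lemma is_derive_flux h r : continuous h -> 0 < r ->
  is_derive r 1 (flux h) (r ^+ m * h r).
Proof. by move=> ch r0; apply: is_derive_prim => //; cont. Qed.

Lemma flux_le0 h r : r <= 0 -> flux h r = 0.
Proof. exact: prim_le0. Qed.

Lemma slope_le0 h r : r <= 0 -> slope h r = 0.
Proof. by move=> r0; rewrite /slope flux_le0// mul0r. Qed.

(** Compare [flux h] with M s^(m+1), giving up a factor 1/(m+1). The linear bound is what makes the
    singular quotient continuous at 0. *)
Lemma norm_slope_le h M b r : continuous h ->
  (forall s, 0 <= s <= b -> `|h s| <= M) -> 0 <= r <= b ->
  `|slope h r| <= M * r.
Proof.
move=> ch hM /andP[r0 rb].
have := r0; rewrite le_eqVlt => /predU1P[<-|r1].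
  by rewrite slope_le0// normr0 mulr0.
have M0 : 0 <= M by apply: le_trans (hM 0 _); rewrite ?normr_ge0// lexx (le_trans r0).
have /= := @is_derive_norm_le_sub R (flux h) (fun s => s ^+ m * h s)
  (fun s => M * s ^+ m.+1) (fun s => M * (m.+1%:R * s ^+ m)) 0 r r0.
rewrite (flux_le0 _ (lexx 0)) subr0 expr0n mulr0 subr0 => H.
have {}H : `|flux h r| <= M * r ^+ m.+1.
  apply: H.
  - exact: continuous_flux.
  - by cont.
  - by move=> s /andP[s0 _]; exact: is_derive_flux.
  - by move=> s _; deriv_eq; ring.
  - move=> s /andP[s0 sr]; rewrite normrM ger0_norm ?exprn_ge0 ?(ltW s0)//.
    rewrite mulrA (mulrC (s ^+ m));apply: ler_wpM2r; first by rewrite exprn_ge0 ?ltW.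
    rewrite (le_trans (hM s _))// ?(ltW s0) ?(ltW (lt_le_trans sr rb))//.
    by rewrite ler_peMr// ler1n.
rewrite /slope normrM normfV ler_pdivrMr ?normr_gt0 ?expf_neq0 ?gt_eqF//.
by rewrite (ger0_norm (exprn_ge0 _ _))// -mulrA -exprS.
Qed.

Lemma continuous_slope h : continuous h -> continuous (slope h).
Proof.
move=> ch x; have [x0|x0|->] := ltgtP x 0.
- have : \forall y \near x, 0 = slope h y.
    by near=> y; rewrite slope_le0//; apply/ltW; near: y; exact: lt_nbhsl.
  move/(@is_derive_near _ (fun=> 0)) => /(_ _ (is_derive_cstE _ _)).
  exact: is_derive_continuous.
- apply: cvgM; first exact: continuous_flux.
  apply: cvgV; first by rewrite expf_neq0// gt_eqF.
  exact: exprn_continuous.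
- have [M [M0 hM]] := @continuous_bounded R h 0 1 ch.
  apply/cvgrPdist_le => /= e e0; rewrite (slope_le0 _ (lexx 0)).
  near=> y; rewrite sub0r normrN; have [y0|y0] := leP y 0.
    by rewrite slope_le0// normr0 ltW.
  rewrite (@le_trans _ _ (M * y))//; last first.
    rewrite -ler_pdivlMl// mulrC ltW//; near: y; apply: lt_nbhsl.
    by rewrite divr_gt0.
  apply: (@norm_slope_le _ _ 1) => //; rewrite ltW//= ltW//.
  by near: y; exact: lt_nbhsl.
Unshelve. all: by end_near. Qed.

Lemma continuous_pot h : continuous h -> continuous (pot h).
Proof. by move=> ch; apply: prim_continuous; exact: continuous_slope. Qed.

Lemma is_derive_pot h r : continuous h -> 0 < r ->
  is_derive r 1 (pot h) (slope h r).
Proof. by move=> ch r0; apply: is_derive_prim => //; exact: continuous_slope. Qed.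

Lemma pot_le0 h r : r <= 0 -> pot h r = 0.
Proof. exact: prim_le0. Qed.

Lemma is_derive_slope h r : continuous h -> 0 < r ->
  is_derive r 1 (slope h) (h r - m%:R / r * slope h r).
Proof.
move=> ch r0; have rn0 : r != 0 by rewrite gt_eqF.
have := is_derive_flux ch r0 => df.
have ? : r ^+ m != 0 by rewrite expf_neq0.
apply: is_derive_eq; first by rewrite /slope; deriv.
(* The case split removes the truncated exponent [m.-1] coming from the derivative of r^m. *)
rewrite /slope /=; move: (flux h r) (h r) => F H; case: m => [|k] /=; first by field.
rewrite !(exprS r k); have : r ^+ k != 0 by rewrite expf_neq0.
by move: (r ^+ k) => q q0; field; rewrite rn0 q0.
Qed.

(* The weight exp(-2r), with the Lipschitz constant 2 of the nonlinearity, turns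
   the Picard map into a contraction of ratio 1/2. *)
Lemma slope_dist h1 h2 C r : continuous h1 -> continuous h2 ->
  (forall s, 0 <= s -> `|h1 s - h2 s| <= C * expR (2 * s)) -> 0 <= r ->
  `|slope h1 r - slope h2 r| <= C / 2 * expR (2 * r).
Proof.
move=> c1 c2 hC r0.
have C0 : 0 <= C.
  by have := hC 0 (lexx 0); rewrite mulr0 expR0 mulr1; apply: le_trans.
have := r0; rewrite le_eqVlt => /predU1P[<-|r1].
  by rewrite !slope_le0// subrr normr0 mulr_ge0 ?expR_ge0 ?divr_ge0.
(* The majorant C/2 s^m exp(2s) has derivative C s^m exp(2s) plus a nonnegative term. Its value at
   0, nonzero only for m = 0, enters with a minus sign and is dropped. *)
have /= := @is_derive_norm_le_sub R (fun s => flux h1 s - flux h2 s)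
  (fun s => s ^+ m * h1 s - s ^+ m * h2 s)
  (fun s => C / 2 * (s ^+ m * expR (2 * s)))
  (fun s => C / 2 * (s ^+ m * (2 * expR (2 * s)) + m%:R * s ^+ m.-1 * expR (2 * s)))
  0 r r0.
have ? := continuous_flux c1; have ? := continuous_flux c2.
rewrite !(flux_le0 _ (lexx 0)) !subr0 => H.
have {}H : `|flux h1 r - flux h2 r| <= C / 2 * (r ^+ m * expR (2 * r)).
  apply: le_trans (H _ _ _ _ _) _.
  - by cont.
  - by cont.
  - move=> s /andP[s0 _]; have ? := is_derive_flux c1 s0.
    by have ? := is_derive_flux c2 s0; deriv.
  - by move=> s _; deriv_eq; ring.
  - move=> s /andP[s0 sr]; rewrite -mulrBr normrM ger0_norm ?exprn_ge0 ?(ltW s0)//.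
    rewrite mulrDr ler_wpDr//.
      by rewrite !mulr_ge0 ?expR_ge0 ?exprn_ge0 ?(ltW s0).
    rewrite mulrCA; apply: ler_wpM2l; first by rewrite exprn_ge0 ?ltW.
    by rewrite (le_trans (hC _ (ltW s0)))// mulrA divfK ?pnatr_eq0.
  - by rewrite gerBl !mulr_ge0 ?expR_ge0 ?exprn_ge0 ?divr_ge0.
rewrite /slope -mulrBl normrM normfV ler_pdivrMr ?normr_gt0 ?expf_neq0 ?gt_eqF//.
by rewrite (ger0_norm (exprn_ge0 _ _))// -[leRHS]mulrA (mulrC (expR _)).
Qed.

(** Integrating exp(2s) once more gains a second factor 1/2 over [slope_dist]. *)
Lemma pot_dist h1 h2 C r : continuous h1 -> continuous h2 ->
  (forall s, 0 <= s -> `|h1 s - h2 s| <= C * expR (2 * s)) -> 0 <= r ->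
  `|pot h1 r - pot h2 r| <= C / 4 * expR (2 * r).
Proof.
move=> c1 c2 hC r0.
have C0 : 0 <= C.
  by have := hC 0 (lexx 0); rewrite mulr0 expR0 mulr1; apply: le_trans.
have /= := @is_derive_norm_le_sub R (fun s => pot h1 s - pot h2 s)
  (fun s => slope h1 s - slope h2 s)
  (fun s => C / 4 * expR (2 * s)) (fun s => C / 2 * expR (2 * s)) 0 r r0.
have ? := continuous_pot c1; have ? := continuous_pot c2.
rewrite !(pot_le0 _ (lexx 0)) !subr0 => H.
apply: le_trans (H _ _ _ _ _) _.
- by cont.
- by cont.
- move=> s /andP[s0 _]; have ? := is_derive_pot c1 s0.
  by have ? := is_derive_pot c2 s0; deriv.
- by move=> s _; deriv_eq; field.
- by move=> s /andP[s0 sr]; exact: slope_dist (ltW s0).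
- by rewrite gerBl !mulr_ge0 ?expR_ge0 ?divr_ge0.
Qed.

End radial_operator.

(** * Global solutions *)

Section nonlinearity.
Context {R : realType} (k : R).
Implicit Types (s t : R).

(** For k = 1 - omega this is s^3/(1+s^2) - omega s. *)
Definition nonlin s : R := k * s - s / (1 + s ^+ 2).

Lemma nonlin0 : nonlin 0 = 0.
Proof. by rewrite /nonlin mulr0 mul0r subr0. Qed.

Lemma one_plus_sqr_gt0 s : 0 < 1 + s ^+ 2.
Proof. by rewrite ltr_pwDl ?sqr_ge0. Qed.

Lemma one_plus_sqr_neq0 s : 1 + s ^+ 2 != 0.
Proof. by rewrite gt_eqF// one_plus_sqr_gt0. Qed.

Lemma continuous_nonlin (u : R -> R) : continuous u ->
  continuous (fun r => nonlin (u r)).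
Proof.
by move=> cu; rewrite /nonlin; cont => x; exact: one_plus_sqr_neq0.
Qed.

(** The difference quotient of s/(1+s^2) is (1 - st)/((1+s^2)(1+t^2)), of modulus at most 1; the
    linear part adds k <= 1. *)
Lemma nonlin_lipschitz s t : 0 <= k <= 1 ->
  `|nonlin s - nonlin t| <= 2 * `|s - t|.
Proof.
move=> /andP[k0 k1].
have s0 := one_plus_sqr_gt0 s; have t0 := one_plus_sqr_gt0 t.
have sn := one_plus_sqr_neq0 s; have tn := one_plus_sqr_neq0 t.
have -> : nonlin s - nonlin t =
    (k - (1 - s * t) / ((1 + s ^+ 2) * (1 + t ^+ 2))) * (s - t).
  by rewrite /nonlin; field; rewrite sn tn.
rewrite normrM ler_wpM2r//.
have : `|(1 - s * t) / ((1 + s ^+ 2) * (1 + t ^+ 2))| <= 1.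
  rewrite ler_norml ler_pdivlMr ?ler_pdivrMr ?mulr_gt0//.
  apply/andP; split; nra.
rewrite !ler_norml => /andP[? ?]; apply/andP; split; lra.
Qed.

End nonlinearity.

Section geometric_limit.
Context {R : realType}.

(** Nested intervals: a_n - 2K/2^n increases, a_n + 2K/2^n decreases, and the supremum of the former
    lies in all the intervals. This gives the rate together with the limit. *)
Lemma geometric_limit (a : nat -> R) (K : R) :
  (forall n, `|a n.+1 - a n| <= K / 2 ^+ n) ->
  exists l, forall n, `|l - a n| <= 2 * K / 2 ^+ n.
Proof.
move=> aK.
pose b n := a n - 2 * K / 2 ^+ n; pose c n := a n + 2 * K / 2 ^+ n.
have K2 n : 2 * K / 2 ^+ n.+1 = K / 2 ^+ n.
  by rewrite exprS; field; rewrite expf_neq0.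
have K2' n : 2 * K / 2 ^+ n = K / 2 ^+ n + K / 2 ^+ n by rewrite -mulrA mulr_natl mulr2n.
have bS n : b n <= b n.+1.
  by have := aK n; rewrite /b K2 K2' ler_norml => /andP[? ?]; lra.
have cS n : c n.+1 <= c n.
  by have := aK n; rewrite /c K2 K2' ler_norml => /andP[? ?]; lra.
have bc n : b n <= c n.
  rewrite /b /c K2'; have := le_trans (normr_ge0 _) (aK n); lra.
have hb : {homo b : i j / (i <= j)%N >-> i <= j} by exact: homo_leq le_trans bS.
have hc : {homo c : i j / (i <= j)%N >-> j <= i}.
  by apply: (homo_leq (r := fun x y => y <= x)) => // x y z xy yz; exact: le_trans yz xy.
have bcn i j : b i <= c j.
  have [ij|/ltnW ji] := leqP i j; first exact: le_trans (hb _ _ ij) (bc j).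
  exact: le_trans (bc i) (hc _ _ ji).
exists (sup (range b)) => n.
rewrite ler_distl; apply/andP; split.
  apply: ub_le_sup; last by exists n.
  by exists (c 0%N) => _ [i _ <-].
by apply: ge_sup; [exists (b 0%N), 0%N|move=> _ [i _ <-]; exact: bcn].
Qed.

End geometric_limit.

(** * Picard iteration and dependence on the initial height *)

Section picard.
Context {R : realType} (m : nat) (k : R).
Hypothesis k01 : 0 <= k <= 1.
Implicit Types (a b r : R) (n : nat) (u : R -> R).

Local Notation g := (nonlin k).

Fixpoint picard a n : R -> R :=
  if n is n'.+1 then fun r => a - pot m (fun s => g (picard a n' s)) r
  else fun=> a.

Lemma picardS a n r :
  picard a n.+1 r = a - pot m (fun s => g (picard a n s)) r.
Proof. by []. Qed.

Lemma continuous_picard a n : continuous (picard a n).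
Proof.
elim: n => [|n IH]; first exact: continuous_cst.
rewrite /=; cont; apply: continuous_pot; exact: continuous_nonlin.
Qed.

Lemma prim_cst0 (f : R -> R) r : (forall x, f x = 0) -> prim f r = 0.
Proof.
move=> f0; have -> : f = cst 0 by apply/funext.
by rewrite /prim Rintegral_cst// mul0r.
Qed.

Lemma pot_cst0 r : pot m (fun=> 0) r = 0.
Proof.
apply: prim_cst0 => x; rewrite /slope /flux prim_cst0 ?mul0r// => y.
by rewrite mulr0.
Qed.

(** The contraction: Lipschitz constant 2 of the nonlinearity times the 1/4 of [pot_dist]. With |r|
    in the weight the bound also holds for r <= 0, where both potentials vanish. *)
Lemma pot_nonlin_dist u v C r : continuous u -> continuous v ->
  (forall s, 0 <= s -> `|u s - v s| <= C * expR (2 * s)) ->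
  `|pot m (fun s => g (u s)) r - pot m (fun s => g (v s)) r|
    <= C / 2 * expR (2 * `|r|).
Proof.
move=> cu cv uv.
have C0 : 0 <= C.
  by have := uv 0 (lexx 0); rewrite mulr0 expR0 mulr1; apply: le_trans.
have [r0|/ltW r0] := leP r 0.
  by rewrite !pot_le0// subrr normr0 mulr_ge0 ?expR_ge0 ?divr_ge0.
rewrite (ger0_norm r0) (_ : C / 2 = (2 * C) / 4); last by field.
apply: pot_dist => // [||s s0]; try exact: continuous_nonlin.
rewrite (le_trans (nonlin_lipschitz _ _ k01))// -mulrA ler_wpM2l//.
exact: uv.
Qed.

Lemma picard_step a n r :
  `|picard a n.+1 r - picard a n r| <= `|a| * expR (2 * `|r|) / 2 ^+ n.
Proof.
elim: n r => [|n IH] r.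
  rewrite /= expr0 divr1 addrAC subrr add0r normrN.
  have cc (c : R) : continuous (fun _ : R => c) by exact: continuous_cst.
  have := @pot_nonlin_dist (fun=> a) (fun=> 0) (2 * `|a|) r (cc _) (cc _).
  rewrite /= nonlin0 pot_cst0 !subr0 => H.
  have -> : `|a| = 2 * `|a| / 2 by field.
  apply: H => s s0; have : 1 <= expR (2 * s) by rewrite -expR0 ler_expR mulr_ge0.
  by have := normr_ge0 a; nra.
have -> : picard a n.+2 r - picard a n.+1 r =
    - (pot m (fun s => g (picard a n.+1 s)) r - pot m (fun s => g (picard a n s)) r).
  by rewrite !picardS; move: (pot _ _ _) (pot _ _ _) => y z; ring.
rewrite normrN.
have := @pot_nonlin_dist (picard a n.+1) (picard a n) (`|a| / 2 ^+ n) r.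
move=> /(_ (@continuous_picard _ _) (@continuous_picard _ _)) H.
apply: le_trans (H _) _.
  by move=> s s0; have := IH s; rewrite (ger0_norm s0) mulrAC.
rewrite le_eqVlt; apply/orP; left; apply/eqP; rewrite exprS; field.
by rewrite expf_neq0.
Qed.

(** The factor 2 is the fixed point of c -> 1 + c/2, so the induction reproduces it at each
    contraction step. *)
Lemma picard_dist a b n r :
  `|picard a n r - picard b n r| <= 2 * `|a - b| * expR (2 * `|r|).
Proof.
have e1 : 1 <= expR (2 * `|r|) by rewrite -expR0 ler_expR mulr_ge0.
have ab0 := normr_ge0 (a - b).
elim: n r e1 => [|n IH] r e1 /=; first by nra.
have := @pot_nonlin_dist (picard a n) (picard b n) (2 * `|a - b|) r.
move=> /(_ (@continuous_picard _ _) (@continuous_picard _ _)) H.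
have {}H := H _.
set x := pot _ _ _; set y := pot _ _ _.
have -> : a - x - (b - y) = (a - b) - (x - y) by ring.
apply: le_trans (ler_normB _ _) _.
have : `|x - y| <= 2 * `|a - b| / 2 * expR (2 * `|r|).
  apply: H => s s0; have := IH s; rewrite (ger0_norm s0); apply.
  by rewrite -expR0 ler_expR mulr_ge0.
by rewrite [2 * _ / 2]mulrAC divff ?pnatr_eq0// mul1r; nra.
Qed.

Lemma picard_limit a : exists u : R -> R, forall n r,
  `|u r - picard a n r| <= 2 * (`|a| * expR (2 * `|r|)) / 2 ^+ n.
Proof.
have /choice[u hu] : forall r, exists l, forall n,
    `|l - picard a n r| <= 2 * (`|a| * expR (2 * `|r|)) / 2 ^+ n.
  by move=> r; apply: geometric_limit => n; exact: picard_step.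
by exists u => n r; exact: hu.
Qed.

Definition flow a : R -> R := sval (cid (picard_limit a)).

Lemma flow_picard a n r :
  `|flow a r - picard a n r| <= 2 * (`|a| * expR (2 * `|r|)) / 2 ^+ n.
Proof. exact: (svalP (cid (picard_limit a))). Qed.

Lemma le_add_exp2 (x y K : R) : (forall n, x <= y + K / 2 ^+ n) -> x <= y.
Proof.
move=> h; have [//|yx] := leP x y.
have [K0|K0] := leP K 0.
  by have := h 0%N; rewrite expr0 divr1; lra.
have [n hn] : exists n, K / (x - y) < 2 ^+ n.
  exists (Num.truncn (K / (x - y))).+1.
  by apply: lt_le_trans (truncnS_gt _) _; rewrite -natrX ler_nat ltnW// ltn_expl.
have := h n; rewrite -lerBlDl ler_pdivlMr ?exprn_gt0//.
by move: hn; rewrite ltr_pdivrMr ?subr_gt0// mulrC => /lt_le_trans/[apply]; rewrite ltxx.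
Qed.

Lemma flow_dist a b r : `|flow a r - flow b r| <= 2 * `|a - b| * expR (2 * `|r|).
Proof.
set A := 2 * (`|a| * expR (2 * `|r|)); set B := 2 * (`|b| * expR (2 * `|r|)).
apply: (@le_add_exp2 _ _ (A + B)) => n.
have -> : flow a r - flow b r = (flow a r - picard a n r) +
    ((picard a n r - picard b n r) - (flow b r - picard b n r)) by ring.
apply: le_trans (ler_normD _ _) _.
have := flow_picard a n r; have := flow_picard b n r; have := picard_dist a b n r.
have := ler_normB (picard a n r - picard b n r) (flow b r - picard b n r).
by rewrite -/A -/B mulrDl; lra.
Qed.

Lemma continuous_flow a : continuous (flow a).
Proof.
move=> x; apply/cvgrPdist_lt => /= e e0.
(* K/2^n bounds the distance to the n-th iterate uniformly for |y| <= |x| + 1, so continuity passes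
   to the limit. *)
pose K := 2 * (`|a| * expR (2 * (`|x| + 1))).
have K0 : 0 <= K by rewrite !mulr_ge0 ?expR_ge0.
have [n hn] : exists n, K / 2 ^+ n <= e / 3.
  have [//|h] := pselect (exists n, K / 2 ^+ n <= e / 3).
  have := @le_add_exp2 (e / 3) 0 K; have : 0 < e / 3 by rewrite divr_gt0.
  move=> /[swap] H; suff : e / 3 <= 0 by lra.
  by apply: H => n; rewrite add0r leNgt; apply/negP => /ltW hn; apply: h; exists n.
have hK y : `|y| <= `|x| + 1 -> `|flow a y - picard a n y| <= e / 3.
  move=> yx; rewrite (le_trans (flow_picard a n y))//.
  apply: le_trans hn; rewrite ler_pM2r ?invr_gt0 ?exprn_gt0//.
  by rewrite !ler_wpM2l// ler_expR ler_wpM2l.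
have e3 : 0 < e / 3 by rewrite divr_gt0.
have /cvgrPdist_lt/(_ _ e3) cp := @continuous_picard a n x.
near=> y.
have yx : `|y| <= `|x| + 1.
  by rewrite -lerBlDl (le_trans (lerB_dist _ _))//.
have py : `|picard a n x - picard a n y| < e / 3 by near: y; exact: cp.
have -> : flow a x - flow a y = (flow a x - picard a n x) +
   ((picard a n x - picard a n y) - (flow a y - picard a n y)) by ring.
have := ler_normD (flow a x - picard a n x)
  ((picard a n x - picard a n y) - (flow a y - picard a n y)).
have := ler_normB (picard a n x - picard a n y) (flow a y - picard a n y).
have := hK y yx; have : `|x| <= `|x| + 1 by rewrite lerDl.
by move=> /hK; lra.
Unshelve. all: by end_near. Qed.

Lemma flowE a r : flow a r = a - pot m (fun s => g (flow a s)) r.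
Proof.
apply/eqP; rewrite -subr_eq0 -normr_le0.
set A := `|a| * expR (2 * `|r|).
apply: (@le_add_exp2 _ _ (2 * A)) => n; rewrite add0r.
have -> : flow a r - (a - pot m (fun s => g (flow a s)) r) =
  (flow a r - picard a n.+1 r) +
  (pot m (fun s => g (flow a s)) r - pot m (fun s => g (picard a n s)) r).
  rewrite picardS; move: (flow a r) (pot _ _ _) (pot _ _ _) => x y z; ring.
apply: le_trans (ler_normD _ _) _.
have h1 := flow_picard a n.+1 r.
have := @pot_nonlin_dist (flow a) (picard a n) (2 * `|a| / 2 ^+ n) r.
move=> /(_ (@continuous_flow _) (@continuous_picard _ _)) H.
have {}H := H _.
have : `|pot m (fun s => g (flow a s)) r - pot m (fun s => g (picard a n s)) r|
    <= 2 * `|a| / 2 ^+ n / 2 * expR (2 * `|r|).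
  apply: H => s s0; have := flow_picard a n s.
  by rewrite (ger0_norm s0) mulrA mulrAC.
have -> : 2 * `|a| / 2 ^+ n / 2 * expR (2 * `|r|) = A / 2 ^+ n.
  by rewrite /A; field; rewrite expf_neq0.
move: h1; rewrite -/A exprS.
have -> : 2 * A / (2 * 2 ^+ n) = A / 2 ^+ n by field; rewrite expf_neq0.
have -> : 2 * A / 2 ^+ n = A / 2 ^+ n + A / 2 ^+ n by field; rewrite expf_neq0.
by lra.
Qed.

End picard.

(** * Energy *)

Section flow_family.
Context {R : realType} (m : nat) (k : R) (k01 : 0 <= k <= 1).
Implicit Types (a b r : R).

Local Notation u := (flow m k01).

(** For r > 0 this is p = - u_a'. *)
Definition mslope a : R -> R := slope m (fun s => nonlin k (u a s)).

Lemma continuous_mslope a : continuous (mslope a).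
Proof.
by apply: continuous_slope; apply: continuous_nonlin; exact: continuous_flow.
Qed.

Lemma flow_at0 a : u a 0 = a.
Proof. by rewrite flowE pot_le0// subr0. Qed.

Lemma mslope_at0 a : mslope a 0 = 0.
Proof. exact: slope_le0. Qed.

Lemma is_derive_flow a r : 0 < r -> is_derive r 1 (u a) (- mslope a r).
Proof.
move=> r0; rewrite (funext (flowE m k01 a)).
have ch : continuous (fun s => nonlin k (u a s)).
  by apply: continuous_nonlin; exact: continuous_flow.
have ? := is_derive_pot m ch r0.
by deriv_eq; rewrite add0r.
Qed.

Lemma is_derive_mslope a r : 0 < r ->
  is_derive r 1 (mslope a) (nonlin k (u a r) - m%:R / r * mslope a r).
Proof.
move=> r0; apply: is_derive_slope => //.
by apply: continuous_nonlin; exact: continuous_flow.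
Qed.

Lemma mslope_dist a b r : 0 <= r ->
  `|mslope a r - mslope b r| <= 2 * `|a - b| * expR (2 * r).
Proof.
move=> r0; have -> : 2 * `|a - b| = 4 * `|a - b| / 2 by field.
apply: slope_dist => // [||s s0].
- by apply: continuous_nonlin; exact: continuous_flow.
- by apply: continuous_nonlin; exact: continuous_flow.
- rewrite (le_trans (nonlin_lipschitz _ _ k01))//.
  by have := flow_dist m k01 a b s; rewrite (ger0_norm s0); lra.
Qed.

Lemma flow00 r : u 0 r = 0.
Proof.
have h n r' : picard m k 0 n r' = 0.
  elim: n r' => [//|n IH] r' /=; rewrite (funext IH).
  by rewrite nonlin0 pot_cst0 subr0.
apply/eqP; rewrite -normr_le0.
by have := flow_picard m k01 0 0 r; rewrite h subr0 normr0 mul0r mulr0 mul0r.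
Qed.

End flow_family.

(** * Energy decay, uniqueness and trapping along one trajectory *)

Section trajectory.
Context {R : realType} (m : nat) (k : R).
Variables (u p : R -> R) (a : R).
Hypotheses (k0 : 0 < k) (k1 : k < 1).
Hypotheses (cu : continuous u) (cp : continuous p) (u0 : u 0 = a) (p0 : p 0 = 0).
Hypothesis du : forall r : R, 0 < r -> is_derive r 1 u (- p r).
Hypothesis dp : forall r : R, 0 < r ->
  is_derive r 1 p (nonlin k (u r) - m%:R / r * p r).
Implicit Types (r s t : R).

Local Notation g := (nonlin k).

Definition potential s : R := (k * s ^+ 2 - ln (1 + s ^+ 2)) / 2.

Definition energy r : R := p r ^+ 2 / 2 + potential (u r).

Local Notation E := energy.

Lemma continuous_energy : continuous E.
Proof.
rewrite /energy /potential; cont => x; exact: one_plus_sqr_gt0.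
Qed.

(** Along the equation E' = - (m/r) p^2: the first-order term acts as friction. *)
Lemma energy_nonincreasing r s : 0 <= r -> r <= s -> E s <= E r.
Proof.
move=> r0 rs; rewrite -lerN2.
apply: (@is_derive_le _ (fun x => - E x) (fun x => m%:R / x * p x ^+ 2)) => //.
- by apply: continuous_opp; exact: continuous_energy.
- move=> x /andP[rx xs]; have x0 : 0 < x := le_lt_trans r0 rx.
  have ? := du x0; have ? := dp x0.
  have ? := one_plus_sqr_gt0 (u x).
  rewrite /energy /potential; deriv_eq; rewrite /nonlin; field.
  by rewrite one_plus_sqr_neq0 gt_eqF.
- move=> x /andP[rx xs]; have x0 : 0 < x := le_lt_trans r0 rx.
  by rewrite mulr_ge0 ?sqr_ge0// divr_ge0// ltW.
Qed.

Lemma norm_nonlin_le s : `|g s| <= 2 * `|s|.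
Proof.
have h : 0 <= k <= 1 by rewrite !ltW.
by have := nonlin_lipschitz s 0 h; rewrite nonlin0 !subr0.
Qed.

(** Backward Gronwall: on [x, r] with x > 0 the coefficient m/y is at most m/x, so N exp(C y) is
    nondecreasing and N vanishes on ]0, r[. Then u' = 0 there, and a = u(0) = u(r) = 0. *)
Lemma trivial_of_double_zero r : 0 < r -> u r = 0 -> p r = 0 -> a = 0.
Proof.
move=> r0 ur pr; pose N x : R := u x ^+ 2 + p x ^+ 2.
have N0 x : 0 < x < r -> N x = 0.
  (* In N', the term 2 u p costs N and 2 p g(u) costs 2 N, because |g(u)| <= 2|u|; 2m/x pays for the
     friction term. *)
  move=> /andP[x0 xr]; pose C : R := 3 + 2 * (m%:R / x).
  have mx0 : 0 <= m%:R / x by rewrite divr_ge0// ltW.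
  have : N x * expR (C * x) <= N r * expR (C * r).
    apply: (@is_derive_le _ (fun y => N y * expR (C * y))
      (fun y => (C * N y + (- 2 * u y * p y +
          2 * p y * (g (u y) - m%:R / y * p y))) * expR (C * y))).
    - exact: ltW.
    - by rewrite /N; cont.
    - move=> y /andP[xy _]; have y0 := lt_trans x0 xy.
      by have ? := du y0; have ? := dp y0; rewrite /N; deriv_eq; ring.
    - move=> y /andP[xy _]; have y0 := lt_trans x0 xy.
      rewrite mulr_ge0 ?expR_ge0//.
      have my : 0 <= m%:R / y <= m%:R / x.
        rewrite divr_ge0 ?(ltW y0)//= ler_wpM2l// lef_pV2 ?posrE//.
        exact: ltW.
      have hg := norm_nonlin_le (u y).
      have : p y * g (u y) >= - (2 * (`|u y| * `|p y|)).
        have : `|p y * g (u y)| <= 2 * (`|u y| * `|p y|).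
          by rewrite normrM; have := normr_ge0 (p y); nra.
        by rewrite ler_norml => /andP[].
      have : u y * p y <= `|u y| * `|p y| by rewrite -normrM ler_norm.
      have : 2 * (`|u y| * `|p y|) <= u y ^+ 2 + p y ^+ 2.
        have := sqr_ge0 (`|u y| - `|p y|).
        rewrite -[u y ^+ 2]real_normK ?num_real//.
        by rewrite -[p y ^+ 2]real_normK ?num_real//; lra.
      move: my => /andP[my0 myx].
      have : 0 <= m%:R / x * u y ^+ 2 by rewrite mulr_ge0 ?sqr_ge0.
      have : 0 <= (m%:R / x - m%:R / y) * p y ^+ 2.
        by rewrite mulr_ge0 ?sqr_ge0 ?subr_ge0.
      have -> : C * N y + (- 2 * u y * p y + 2 * p y * (g (u y) - m%:R / y * p y))
          = 3 * (u y ^+ 2 + p y ^+ 2) + 2 * (m%:R / x * u y ^+ 2)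
          + 2 * ((m%:R / x - m%:R / y) * p y ^+ 2) - 2 * (u y * p y)
          + 2 * (p y * g (u y)) by rewrite /C /N; ring.
      by lra.
  have Nr : N r = 0 by rewrite /N ur pr expr0n addr0.
  rewrite Nr mul0r pmulr_lle0 ?expR_gt0// => NN.
  by apply/eqP; rewrite eq_le NN addr_ge0 ?sqr_ge0.
have := @is_derive_norm_le_sub R u (fun x => - p x) (fun=> 0) (fun=> 0) 0 r (ltW r0)
  cu (@continuous_cst _ 0).
rewrite u0 ur sub0r normrN subr0 normr_le0 => H; apply/eqP; apply: H.
- by move=> x /andP[x0 _]; exact: du.
- move=> x /N0; rewrite /N normrN => /eqP.
  rewrite paddr_eq0 ?sqr_ge0// => /andP[_].
  by rewrite sqrf_eq0 => /eqP ->; rewrite normr0.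
Qed.

(** Reaching a nonpositive value requires a zero of u, where E = p^2/2 >= 0; but E stays negative
    after r. *)
Lemma trapped r : 0 <= r -> E r < 0 -> 0 < u r -> forall s, r <= s -> 0 < u s.
Proof.
move=> r0 Er ur s rs; rewrite ltNge; apply/negP => us.
have [c] : exists2 c, c \in `[r, s] & u c = 0.
  apply: IVT => //; first exact: continuous_subspaceT.
  by rewrite ge_min us orbT le_max ltW.
rewrite in_itv/= => /andP[rc cs] uc.
have := energy_nonincreasing r0 rc.
rewrite /energy uc /potential expr0n/= mulr0 addr0 ln1.
rewrite subrr mul0r addr0; have := sqr_ge0 (p c).
by move: Er; rewrite /energy /potential; lra.
Qed.

End trajectory.

(** * Positive solutions of nonnegative energy *)

Section potential_bounds.
Context {R : realType}.
Implicit Types (k s t : R).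

(** This is ln(1+t) >= 2t/(2+t) at t = s^2. The two sides agree to second order in t, which is
    precise enough both for the sign of g where G >= 0 and for a quadratic upper bound on G near
    0. *)
Lemma ln_one_plus_sqr_ge s : 0 <= s ->
  2 * s ^+ 2 / (2 + s ^+ 2) <= ln (1 + s ^+ 2).
Proof.
move=> s0; have n2 x : 0 < 2 + x ^+ 2 :> R by rewrite ltr_pwDl ?sqr_ge0.
rewrite -subr_ge0.
pose f (x : R) := ln (1 + x ^+ 2) - 2 * x ^+ 2 / (2 + x ^+ 2).
have -> : 0 = f 0 by rewrite /f expr0n/= addr0 ln1 mulr0 mul0r subr0.
apply: (@is_derive_le _ f
  (fun x => 2 * x ^+ 5 / ((1 + x ^+ 2) * (2 + x ^+ 2) ^+ 2))) => //.
- rewrite /f; cont => x; first exact: one_plus_sqr_gt0.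
  by rewrite gt_eqF.
- move=> x _; have ? := one_plus_sqr_gt0 x.
  have ? : 2 + x ^+ 2 != 0 by rewrite gt_eqF.
  by rewrite /f; deriv_eq; field; apply/andP; split=> //; exact: one_plus_sqr_neq0.
- move=> x /andP[x0 _].
  by rewrite divr_ge0 ?mulr_ge0 ?exprn_ge0 ?(ltW x0) ?(ltW (n2 x))
    ?(ltW (one_plus_sqr_gt0 x)).
Qed.

(** With t = s^2, G(s) >= 0 forces k(2+t) >= 2, hence k(1+t) >= 2(1+t)/(2+t) > 1. By [nonlinE] the
    conclusion is the positivity of g(s). *)
Lemma potential_ge0_gt k s : 0 < s -> 0 <= potential k s -> 1 < k * (1 + s ^+ 2).
Proof.
move=> s0; rewrite /potential => h.
have := ln_one_plus_sqr_ge (ltW s0); have s2 : 0 < s ^+ 2 by rewrite exprn_gt0.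
rewrite ler_pdivrMr; last by rewrite ltr_pwDl ?sqr_ge0.
move: h s2; move: (ln (1 + s ^+ 2)) (s ^+ 2) => l t h t0 hl.
have : 2 * t <= k * t * (2 + t) by nra.
nra.
Qed.

Lemma nonlinE k s : nonlin k s = s * (k * (1 + s ^+ 2) - 1) / (1 + s ^+ 2).
Proof. by rewrite /nonlin; field; rewrite one_plus_sqr_neq0. Qed.

Lemma nonlin_gt0 k s : 0 < s -> 1 < k * (1 + s ^+ 2) -> 0 < nonlin k s.
Proof.
by move=> s0 h; rewrite nonlinE divr_gt0 ?one_plus_sqr_gt0// mulr_gt0 ?subr_gt0.
Qed.

Lemma continuous_gt0_near (f : R -> R) c : continuous f -> 0 < f c ->
  exists2 e, 0 < e & forall x, `|x - c| <= e -> 0 < f x.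
Proof.
move=> cf fc; have /cvgrPdist_lt/(_ _ fc) [e /= e0 he] := cf c.
exists (e / 2) => [|x xc]; first by rewrite divr_gt0.
have : `|f c - f x| < f c by apply: he => /=; rewrite distrC (le_lt_trans xc)//; lra.
by rewrite ltr_norml => /andP[_]; lra.
Qed.

End potential_bounds.

Section positive_trajectory.
Context {R : realType} (m : nat) (k : R).
Variables (u p : R -> R) (a : R).
Hypotheses (k0 : 0 < k) (k1 : k < 1).
Hypotheses (cu : continuous u) (cp : continuous p) (u0 : u 0 = a) (p0 : p 0 = 0).
Hypothesis du : forall r : R, 0 < r -> is_derive r 1 u (- p r).
Hypothesis dp : forall r : R, 0 < r ->
  is_derive r 1 p (nonlin k (u r) - m%:R / r * p r).
Implicit Types (r s t : R).

Local Notation g := (nonlin k).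
Hypotheses (a0 : 0 < a) (u_gt0 : forall r, 0 <= r -> 0 < u r)
  (E_ge0 : forall r, 0 <= r -> 0 <= energy k u p r).

(** The weight absorbs the singular term, H' = r^m g(u), and H has the sign of p for r > 0. *)
Let H r := r ^+ m * p r.

Let cH : continuous H. Proof. by rewrite /H; cont. Qed.

Let H0 : H 0 = 0. Proof. by rewrite /H p0 mulr0. Qed.

Let cg : continuous (fun r => g (u r)). Proof. exact: continuous_nonlin. Qed.

Let dH r : 0 < r -> is_derive r 1 H (r ^+ m * g (u r)).
Proof.
move=> r0; have rn0 : r != 0 by rewrite gt_eqF.
have ? := dp r0; rewrite /H; deriv_eq.
case: (m) => [|n] /=; first by rewrite !expr0; field.
by rewrite exprS; field.
Qed.

Lemma weighted_slope_increment c s r : 0 <= s -> s <= r ->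
  (forall x, s < x < r -> c <= g (u x)) ->
  c / m.+1%:R * (r ^+ m.+1 - s ^+ m.+1) <= H r - H s.
Proof.
move=> s0 sr hc; rewrite mulrBr.
apply: (@is_derive_le_sub _ (fun x => c / m.+1%:R * x ^+ m.+1) (fun x => c * x ^+ m)
  H (fun x => x ^+ m * g (u x))) => //.
- by cont.
- by move=> x _; deriv_eq; field.
- by move=> x /andP[sx _]; apply: dH; exact: le_lt_trans sx.
- move=> x sxr; rewrite mulrC ler_wpM2l ?hc// exprn_ge0//.
  by move: sxr => /andP[sx _]; rewrite ltW// (le_lt_trans _ sx).
Qed.

Let g_gt0 r : 0 <= r -> p r = 0 -> 0 < g (u r).
Proof.
move=> r0 pr; apply: nonlin_gt0; first exact: u_gt0.
apply: potential_ge0_gt; first exact: u_gt0.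
by have := E_ge0 r0; rewrite /energy pr expr0n/= mul0r add0r.
Qed.

(** Let c be the infimum of the points where H <= 0. Since g(u(0)) > 0, H increases from 0 at first,
    so c > 0. By continuity H(c) = 0, hence p(c) = 0 and g(u) > 0 near c; so H is nondecreasing just
    before c, up to the value 0, although H > 0 on ]0, c[. *)
Lemma slope_gt0 r : 0 < r -> 0 < p r.
Proof.
move=> r0; rewrite ltNge; apply/negP => pr.
have HE x : 0 < x -> (0 < H x) = (0 < p x).
  by move=> x0; rewrite /H pmulr_rgt0// exprn_gt0.
pose S := [set x | 0 < x /\ H x <= 0].
have Sr : S r by split=> //; rewrite leNgt HE// -leNgt.
have [e e0 he] := continuous_gt0_near cg (g_gt0 (lexx 0) p0).
have Se x : S x -> e <= x.
  move=> [x0 Hx]; rewrite leNgt; apply/negP => xe.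
  have [||c [c0 hc]] := continuous_pos_min (a := 0) (b := x) _ cg.
  - exact: ltW.
  - by move=> y /andP[y0 yx]; apply: he; rewrite subr0 ger0_norm// (le_trans yx)// ltW.
  have := @weighted_slope_increment c 0 x (lexx 0) (ltW x0).
  rewrite H0 subr0 expr0n/= subr0 => h.
  have : 0 < c / m.+1%:R * x ^+ m.+1 by rewrite mulr_gt0 ?exprn_gt0 ?divr_gt0.
  rewrite ltNge => /negP; apply; apply: le_trans Hx; apply: h => y /andP[y0 yx].
  by apply: hc; rewrite !ltW.
have S0 : S !=set0 by exists r.
have Slb : has_lbound S by exists e => x /Se.
pose c := inf S.
have c0 : 0 < c by apply: lt_le_trans e0 _; apply: lb_le_inf => // x /Se.
have below x : 0 < x -> x < c -> 0 < H x.
  move=> x0 xc; rewrite ltNge; apply/negP => Hx.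
  by have : c <= x by [exact: ge_inf]; rewrite leNgt xc.
have left d : 0 < d -> exists x, [/\ 0 < x, x < c & c - x <= d].
  move=> d0; exists (c - Num.min d (c / 2)).
  have : Num.min d (c / 2) <= d by rewrite ge_min lexx.
  have : Num.min d (c / 2) <= c / 2 by rewrite ge_min lexx orbT.
  have : 0 < Num.min d (c / 2) by rewrite lt_min d0 divr_gt0.
  by move=> ? ? ?; split; lra.
have Hc0 : H c = 0.
  apply/eqP; rewrite eq_le; apply/andP; split; rewrite leNgt; apply/negP => Hc.
    have [d d0 hd] := continuous_gt0_near cH Hc.
    have [x Sx xc] := inf_adherent d0 (conj S0 Slb).
    have cx : c <= x by exact: ge_inf.
    have : 0 < H x by apply: hd; rewrite ger0_norm ?subr_ge0// lerBlDl ltW.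
    by rewrite ltNge Sx.2.
  have cHN : continuous (fun x => - H x) by cont.
  have [|d d0 hd] := continuous_gt0_near (c := c) cHN; first by rewrite oppr_gt0.
  have [x [x0 xc cxd]] := left d d0.
  have := below x x0 xc; have : 0 < - H x.
    by apply: hd; rewrite distrC ger0_norm// subr_ge0 ltW.
  by lra.
have pc : p c = 0.
  by move/eqP: Hc0; rewrite mulf_eq0 expf_eq0 gt_eqF// andbF/= => /eqP.
have [d d0 hd] := continuous_gt0_near cg (g_gt0 (ltW c0) pc).
have [x [x0 xc cxd]] := left d d0.
have := @weighted_slope_increment 0 x c (ltW x0) (ltW xc).
rewrite !mul0r Hc0 sub0r => h; have := below x x0 xc.
suff : 0 <= - H x by lra.
apply: h => y /andP[xy yc]; apply/ltW/hd.
by rewrite distrC ger0_norm ?subr_ge0 ?(ltW yc)//; lra.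
Qed.

Lemma trajectory_decreasing r s : 0 <= r -> r <= s -> u s <= u r.
Proof.
move=> r0 rs; rewrite -lerN2.
apply: (@is_derive_le _ (fun x => - u x) p) => //; first by cont.
  move=> x /andP[rx _]; have ? := du (le_lt_trans r0 rx).
  by deriv_eq; rewrite opprK.
by move=> x /andP[rx _]; apply/ltW/slope_gt0; exact: le_lt_trans rx.
Qed.

(** b^2 lies strictly between (1-k)/k, above which g > 0, and 2(1-k)/k, below which 2/(2 + s^2) > k
    and G is negative by [ln_one_plus_sqr_ge]. *)
Let b := Num.sqrt (3 * (1 - k) / (2 * k)).

Let b2 : b ^+ 2 = 3 * (1 - k) / (2 * k).
Proof. by rewrite sqr_sqrtr// divr_ge0 ?mulr_ge0 ?subr_ge0// ltW. Qed.

Let b0 : 0 < b.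
Proof. by rewrite sqrtr_gt0 divr_gt0 ?mulr_gt0 ?subr_gt0. Qed.

(** If u stayed in [b, a], g(u) would be at least some c > 0, so p >= c x/(m+1) and u would decrease
    quadratically, down to negative values. *)
Let drops_below : exists2 r, 0 < r & u r <= b.
Proof.
have [//|nb] := pselect (exists2 r, 0 < r & u r <= b).
have ub x : 0 < x -> b < u x.
  by move=> x0; rewrite ltNge; apply/negP => xb; apply: nb; exists x.
have ua x : 0 <= x -> u x <= a by move=> x0; rewrite -u0; exact: trajectory_decreasing.
have ba : b <= a by apply/ltW/(lt_le_trans (ub 1 ltr01))/ua.
have cgid : continuous (fun s => g s).
  by apply: continuous_nonlin; exact: continuous_idE.
have [|c [c0 hc]] := continuous_pos_min ba cgid.
  move=> s /andP[bs sa]; have s0 := lt_le_trans b0 bs.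
  apply: nonlin_gt0 => //.
  have : b ^+ 2 <= s ^+ 2 by rewrite ler_sqr// nnegrE ltW.
  rewrite b2 ler_pdivrMr ?mulr_gt0//; nra.
have pc x : 0 < x -> c / m.+1%:R * x <= p x.
  move=> x0; have := @weighted_slope_increment c 0 x (lexx 0) (ltW x0).
  rewrite H0 subr0 expr0n/= subr0 /H exprSr mulrCA.
  rewrite ler_pM2l ?exprn_gt0// mulrC; apply => y /andP[y0 _]; apply: hc.
  by rewrite ltW ?ub// ua// ltW.
(* As x >= 1, the drop c x^2/(2(m+1)) is at least c x/(2(m+1)), which exceeds a. *)
pose x : R := 1 + 2 * m.+1%:R * a / c.
have x1 : 1 <= x by rewrite lerDl divr_ge0 ?mulr_ge0// ltW.
have x0 : 0 < x by apply: lt_le_trans x1.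
have := @is_derive_le_sub R (fun y => c / (2 * m.+1%:R) * y ^+ 2)
  (fun y => c / m.+1%:R * y) (fun y => - u y) p 0 x (ltW x0).
rewrite expr0n/= mulr0 subr0 u0 opprK => h.
have : c / (2 * m.+1%:R) * x ^+ 2 <= - u x + a.
  apply: h.
  - by cont.
  - by cont.
  - by move=> y _; deriv_eq; field.
  - by move=> y /andP[y0 _]; have ? := du y0; deriv_eq; rewrite opprK.
  - by move=> y /andP[y0 _]; exact: pc.
have : c / (2 * m.+1%:R) * x <= c / (2 * m.+1%:R) * x ^+ 2.
  by rewrite ler_pM2l ?divr_gt0 ?mulr_gt0// expr2 ler_peMr// ltW.
have -> : c / (2 * m.+1%:R) * x = c / (2 * m.+1%:R) + a.
  by rewrite /x; field; apply/andP; split=> //; rewrite gt_eqF.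
have : 0 < c / (2 * m.+1%:R) by rewrite divr_gt0 ?mulr_gt0.
have := u_gt0 (ltW x0); move: (u x) (c / _) (x ^+ 2) => v q y.
by lra.
Qed.

Lemma trajectory_le_slope : exists r c, [/\ 0 < r, 0 < c &
  forall x, r <= x -> c * u x <= p x].
Proof.
have [r r0 ur] := drops_below.
pose c2 := 2 / (2 + b ^+ 2) - k.
have b20 : 0 < 2 + b ^+ 2 by rewrite ltr_pwDl ?sqr_ge0.
have c20 : 0 < c2.
  rewrite subr_gt0 ltr_pdivlMr// b2.
  have -> : k * (2 + 3 * (1 - k) / (2 * k)) = 3 / 2 + k / 2 by field; rewrite gt_eqF.
  by move: k1; lra.
exists r, (Num.sqrt c2); split; rewrite ?sqrtr_gt0// => x rx.
have x0 := lt_le_trans r0 rx; have ux := u_gt0 (ltW x0).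
rewrite -ler_sqr ?nnegrE ?mulr_ge0 ?sqrtr_ge0 ?(ltW ux) ?(ltW (slope_gt0 x0))//.
rewrite exprMn sqr_sqrtr ?(ltW c20)//.
have := E_ge0 (ltW x0); rewrite /energy /potential => h.
have hl := ln_one_plus_sqr_ge (ltW ux).
have ub : u x ^+ 2 <= b ^+ 2.
  rewrite ler_sqr ?nnegrE ?(ltW ux) ?(ltW b0)//.
  exact: le_trans (trajectory_decreasing (ltW r0) rx) ur.
have : 2 * u x ^+ 2 / (2 + b ^+ 2) <= 2 * u x ^+ 2 / (2 + u x ^+ 2).
  apply: ler_wpM2l; first by rewrite mulr_ge0 ?sqr_ge0.
  by rewrite lef_pV2 ?posrE ?lerD2l// ltr_pwDl ?sqr_ge0.
have -> : c2 * u x ^+ 2 = 2 * u x ^+ 2 / (2 + b ^+ 2) - k * u x ^+ 2.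
  by rewrite /c2; field; rewrite gt_eqF.
by lra.
Qed.

(** p^2 = 2E - 2G(u), where E is at most its initial value and -2G(u) <= ln(1+u^2) <= u^2 <= a^2. *)
Lemma slope_sqr_le r : 0 <= r -> p r ^+ 2 <= 2 * energy k u p 0 + a ^+ 2.
Proof.
move=> r0; have := energy_nonincreasing cu cp du dp (lexx 0) r0.
rewrite {1}/energy /potential.
have : ln (1 + u r ^+ 2) <= u r ^+ 2.
  by apply: le_ln1Dx; rewrite (lt_le_trans _ (sqr_ge0 _))// ltrN10.
have : u r ^+ 2 <= a ^+ 2.
  rewrite ler_sqr ?nnegrE ?(ltW a0) ?(ltW (u_gt0 r0))// -u0.
  exact: trajectory_decreasing.
have := mulr_ge0 (ltW k0) (sqr_ge0 (u r)).
by lra.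
Qed.

(** Keeps (m/r) p bounded near 0, as the L^2 bound on u'' requires. *)
Lemma slope_le_linear b' : exists2 M, 0 < M & forall r, 0 <= r <= b' -> p r <= M * r.
Proof.
have [M [M0 hM]] := @continuous_bounded R (fun r => g (u r)) 0 b' cg.
exists M => // r /andP[r0]; move: r0; rewrite le_eqVlt => /predU1P[<- _|r0 rb].
  by rewrite p0 mulr0.
have := @is_derive_le_sub R H (fun x => x ^+ m * g (u x))
  (fun x => M * x ^+ m.+1) (fun x => M * (m.+1%:R * x ^+ m)) 0 r (ltW r0) cH.
rewrite H0 subr0 expr0n/= mulr0 subr0 /H exprSr mulrCA.
rewrite ler_pM2l ?exprn_gt0//; apply.
- by cont.
- by move=> x /andP[x0 _]; exact: dH.
- by move=> x _; deriv_eq; ring.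
- move=> x /andP[x0 xr]; rewrite mulrCA mulrA mulrC ler_wpM2r ?exprn_ge0 ?(ltW x0)//.
  rewrite (le_trans (ler_norm _))// (le_trans (hM _ _))//.
    by rewrite (ltW x0) ltW// (lt_le_trans xr).
  by rewrite ler_peMl ?(ltW M0)// ler1n.
Qed.

End positive_trajectory.

(** * Solutions of large height change sign *)

Section shooting.
Context {R : realType} (m : nat) (k : R).
Hypotheses (k0 : 0 < k) (k1 : k < 1) (k01 : 0 <= k <= 1).
Implicit Types (a b r : R).

Local Notation u := (flow m k01).
Local Notation p := (mslope m k01).
Local Notation g := (nonlin k).

Let cu a : continuous (u a). Proof. exact: continuous_flow. Qed.
Let cp a : continuous (p a). Proof. exact: continuous_mslope. Qed.
Let du a r : 0 < r -> is_derive r 1 (u a) (- p a r).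
Proof. exact: is_derive_flow. Qed.
Let dp a r : 0 < r -> is_derive r 1 (p a) (g (u a r) - m%:R / r * p a r).
Proof. exact: is_derive_mslope. Qed.

Let mslope0 r : p 0 r = 0.
Proof.
rewrite /mslope /slope /flux prim_cst0 ?mul0r// => y.
by rewrite flow00 nonlin0 mulr0.
Qed.

(** Comparison with the zero solution bounds |p_a| by 2 a exp(2) on [0, 1]. The bound is
    proportional to a, so u_a stays above a/2 on an interval independent of a. *)
Lemma flow_dist_initial a r : 0 < a -> 0 <= r <= 1 ->
  `|u a r - a| <= 2 * a * expR 2 * r.
Proof.
move=> a0 /andP[r0 r1].
have := @is_derive_norm_le_sub R (u a) (fun x => - p a x)
  (fun x => 2 * a * expR 2 * x) (fun=> 2 * a * expR 2) 0 r r0 (@cu a).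
rewrite flow_at0 mulr0 subr0; apply.
- by cont.
- by move=> x /andP[x0 _]; exact: du.
- by move=> x _; deriv_eq; ring.
- move=> x /andP[x0 xr]; rewrite normrN.
  have := mslope_dist m k01 a 0 (ltW x0); rewrite mslope0 !subr0 (gtr0_norm a0).
  move/le_trans; apply; rewrite ler_wpM2l ?mulr_ge0 ?(ltW a0)// ler_expR.
  by rewrite ler_piMr// ltW// (lt_le_trans xr).
Qed.

(* Test the equation, whose nonlinear part is u / (1 + u^2) <= 1/2, against
   psi = (b^2 - r^2)^2.  This function vanishes to second order at b and, for b
   large, psi'' + (m/r) psi' + k psi >= 1, so that a solution that stays
   nonnegative on [0, b] has a bounded mean.  Phi is the Wronskian
   r^m (psi u' - psi' u). *)
Lemma flow_crosses_zero : exists a, 0 < a /\ exists r, 0 < r /\ u a r < 0.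
Proof.
(* With s = b^2 - r^2, psi = s^2 satisfies psi'' + (m/r) psi' = 8 b^2 - B s. *)
have [B BE] : exists B : R, B = 4 * m.+1%:R + 8 by eexists.
(* Completing the square, k s^2 - B s >= - B^2/(4k) = 1 - b, so adding 8 b^2 gives at least 1. *)
have [b [b1 bB]] : exists b : R, 1 <= b /\ b = 1 + B ^+ 2 / (4 * k).
  exists (1 + B ^+ 2 / (4 * k)); split=> //.
  by rewrite lerDl divr_ge0 ?sqr_ge0// mulr_ge0// ltW.
have b0 : 0 < b by apply: lt_le_trans b1.
(* By [flow_dist_initial], u_a >= a/2 on ]0, c[. *)
have [c [c0 c1 cE]] : exists c : R, [/\ 0 < c, c <= 1 & expR 2 * c = 4^-1].
  have e1 : 1 <= expR 2 :> R by rewrite -expR0 ler_expR.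
  have e0 : 0 < expR 2 :> R by exact: expR_gt0.
  exists (4 * expR 2)^-1; split; first by rewrite invr_gt0 mulr_gt0.
    by rewrite invf_le1 ?mulr_gt0//; lra.
  by field; rewrite gt_eqF.
have cm : 0 < c ^+ m.+1 by rewrite exprn_gt0.
(* Up to the factor 1/(2(m+1)), the left side bounds the nonlinear contribution on ]0, b[ and the
   right side is what the linear part gains on ]0, c[. *)
have [a [a0 ha]] : exists a : R, 0 < a /\ b ^+ m.+1 * b ^+ 4 < a * c ^+ m.+1.
  exists (b ^+ m.+1 * b ^+ 4 / c ^+ m.+1 + 1); split.
    by rewrite ltr_wpDl// divr_ge0 ?mulr_ge0 ?exprn_ge0 ?(ltW b0) ?(ltW c0).
  by rewrite mulrDl divfK ?gt_eqF// mul1r ltrDl.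
exists a; split=> //.
have [//|nr] := pselect (exists r, 0 < r /\ u a r < 0); exfalso.
have u_ge0 r : 0 < r -> 0 <= u a r.
  by move=> r0; rewrite leNgt; apply/negP => h; apply: nr; exists r.
pose s (x : R) := b ^+ 2 - x ^+ 2.
pose Phi (x : R) := x ^+ m * (4 * x * s x * u a x - s x ^+ 2 * p a x).
pose Phi' (x : R) := x ^+ m * (s x ^+ 2 * (u a x / (1 + u a x ^+ 2))
  - u a x * (k * s x ^+ 2 - B * s x + 8 * b ^+ 2)).
have cPhi : continuous Phi.
  by have ? := @cu a; have ? := @cp a; rewrite /Phi /s; cont.
have dPhi (x : R) : 0 < x -> is_derive x 1 Phi (Phi' x).
  move=> x0; have ? := @du a x x0; have ? := @dp a x x0.
  have ? : x != 0 by rewrite gt_eqF.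
  rewrite /Phi /s; deriv_eq; rewrite /Phi' /s /nonlin BE.
  move: (one_plus_sqr_neq0 (u a x)); move: (u a x) (p a x) => v q vn.
  case: (m) => [|n] /=; first by rewrite expr0; field; apply/andP.
  by rewrite (exprS x n); field; apply/andP.
(* As Phi vanishes at 0 and b, the upper bounds for its increments over [0, c] and [c, b] have a
   nonnegative sum, which the choice of a contradicts. *)
have Phi0 : Phi 0 = 0 by rewrite /Phi mulr0 !mul0r mslope_at0 mulr0 subr0 mulr0.
have Phib : Phi b = 0 by rewrite /Phi /s subrr mulr0 expr0n/= !mul0r subr0 mulr0.
have Phi'_le l x : 0 < x < b -> l <= u a x -> 0 <= l ->
    Phi' x <= (b ^+ 4 / 2 - l) * x ^+ m.
  move=> /andP[x0 xb] lu l0; rewrite /Phi' mulrC; apply: ler_wpM2r.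
    by rewrite exprn_ge0// ltW.
  have ux := u_ge0 _ x0.
  have s0 : 0 <= s x by rewrite subr_ge0 ler_sqr ?nnegrE ?ltW.
  have sb : s x <= b ^+ 2 by rewrite gerBl sqr_ge0.
  have q1 : 1 <= k * s x ^+ 2 - B * s x + 8 * b ^+ 2.
    have bb : b <= b ^+ 2 by rewrite expr2 ler_peMr// ltW.
    have := mulr_ge0 (ltW k0) (sqr_ge0 (s x - B / (2 * k))).
    have -> : k * (s x - B / (2 * k)) ^+ 2 =
      k * s x ^+ 2 - B * s x + B ^+ 2 / (4 * k) by field; rewrite gt_eqF.
    by move: bb; rewrite {1}bB; move: (sqr_ge0 b); lra.
  have h0 : u a x / (1 + u a x ^+ 2) <= 2^-1.
    rewrite ler_pdivrMr ?one_plus_sqr_gt0//.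
    by have := sqr_ge0 (u a x - 1); lra.
  have : s x ^+ 2 * (u a x / (1 + u a x ^+ 2)) <= b ^+ 4 * 2^-1.
    apply: ler_pM => //; rewrite ?sqr_ge0//.
      by rewrite divr_ge0// ltW ?one_plus_sqr_gt0.
    by rewrite (exprM b 2 2) ler_sqr ?nnegrE ?sqr_ge0.
  have : l <= u a x * (k * s x ^+ 2 - B * s x + 8 * b ^+ 2).
    by rewrite (le_trans lu)// ler_peMr.
  by lra.
have step l y z : 0 <= y -> y <= z -> z <= b ->
    (forall x, y < x < z -> l <= u a x) -> 0 <= l ->
    Phi z - Phi y <= (b ^+ 4 / 2 - l) / m.+1%:R * (z ^+ m.+1 - y ^+ m.+1).
  move=> y0 yz zb hl l0; rewrite mulrBr.
  apply: (@is_derive_le_sub _ Phi Phi' (fun x => (b ^+ 4 / 2 - l) / m.+1%:R * x ^+ m.+1)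
    (fun x => (b ^+ 4 / 2 - l) * x ^+ m)).
  - exact: yz.
  - exact: cPhi.
  - by cont.
  - by move=> x /andP[yx _]; apply: dPhi; exact: le_lt_trans yx.
  - by move=> x _; deriv_eq; field.
  - move=> x /andP[yx xz]; apply: Phi'_le => //; last by apply: hl; rewrite yx.
    by rewrite (le_lt_trans y0 yx) (lt_le_trans xz zb).
have near0 x : 0 < x < c -> a / 2 <= u a x.
  move=> /andP[x0 xc]; have := @flow_dist_initial a x a0.
  rewrite (ltW x0) (ltW (lt_le_trans xc c1)) => /(_ isT).
  have : 2 * a * expR 2 * x <= 2 * a * expR 2 * c.
    by rewrite ler_wpM2l ?(ltW xc)// !mulr_ge0 ?ltW.
  rewrite -[X in _ <= X]mulrA cE.
  by rewrite ler_norml => ? /andP[? _]; lra.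
have := step (a / 2) 0 c (lexx 0) (ltW c0) (le_trans c1 b1) near0.
have := step 0 c b (ltW c0) (le_trans c1 b1) (lexx b).
rewrite Phi0 Phib expr0n/= !subr0 sub0r => h1 h2.
have {}h1 : - Phi c <= b ^+ 4 / 2 / m.+1%:R * (b ^+ m.+1 - c ^+ m.+1).
  by apply: h1 => // x /andP[cx _]; exact/u_ge0/(lt_trans c0).
have {}h2 : Phi c <= (b ^+ 4 / 2 - a / 2) / m.+1%:R * c ^+ m.+1.
  by apply: h2; rewrite divr_ge0// ltW.
have : 0 <= (b ^+ m.+1 * b ^+ 4 - a * c ^+ m.+1) / (2 * m.+1%:R).
  have -> : (b ^+ m.+1 * b ^+ 4 - a * c ^+ m.+1) / (2 * m.+1%:R) =
    b ^+ 4 / 2 / m.+1%:R * (b ^+ m.+1 - c ^+ m.+1) +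
    (b ^+ 4 / 2 - a / 2) / m.+1%:R * c ^+ m.+1 by field.
  by have := lerD h1 h2; rewrite addNr.
by rewrite ler_pdivlMr ?mulr_gt0// mul0r subr_ge0 leNgt ha.
Qed.

End shooting.

(** * The critical height *)

Section critical_height.
Context {R : realType} (m : nat) (k : R).
Hypotheses (k0 : 0 < k) (k1 : k < 1) (k01 : 0 <= k <= 1).
Implicit Types (a b r : R).

Local Notation u := (flow m k01).
Local Notation p := (mslope m k01).
Local Notation E a := (energy k (u a) (p a)).

Let cu a : continuous (u a). Proof. exact: continuous_flow. Qed.
Let cp a : continuous (p a). Proof. exact: continuous_mslope. Qed.
Let du a r : 0 < r -> is_derive r 1 (u a) (- p a r).
Proof. exact: is_derive_flow. Qed.
Let dp a r : 0 < r ->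
  is_derive r 1 (p a) (nonlin k (u a r) - m%:R / r * p a r).
Proof. exact: is_derive_mslope. Qed.

Lemma lipschitz_continuous (f : R -> R) (K : R) :
  (forall a b, `|f a - f b| <= K * `|a - b|) -> continuous f.
Proof.
move=> fK a; apply/cvgrPdist_lt => /= e e0.
have K1 : 0 < `|K| + 1 by rewrite ltr_wpDl.
near=> b.
have : `|a - b| < e / (`|K| + 1).
  by near: b; exists (e / (`|K| + 1)) => //=; rewrite divr_gt0.
rewrite ltr_pdivlMr// => ab; apply: le_lt_trans (fK a b) (le_lt_trans _ ab).
rewrite mulrC ler_wpM2l// (le_trans (ler_norm K))// lerDl.
by [].
Unshelve. all: by end_near. Qed.

Let continuous_flow_initial r : 0 <= r -> continuous (fun a => u a r).
Proof.
move=> r0; apply: (@lipschitz_continuous _ (2 * expR (2 * r))) => a b.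
by have := flow_dist m k01 a b r; rewrite (ger0_norm r0); lra.
Qed.

Let continuous_mslope_initial r : 0 <= r -> continuous (fun a => p a r).
Proof.
move=> r0; apply: (@lipschitz_continuous _ (2 * expR (2 * r))) => a b.
by have := mslope_dist m k01 a b r0; lra.
Qed.

Let crossing := [set a | 0 < a /\ exists r, 0 < r /\ u a r < 0].

(** Otherwise the initial energy G(a) is negative and [trapped] keeps the solution positive. *)
Let crossing_potential a : crossing a -> 0 <= potential k a.
Proof.
move=> [a0 [r [r0 ur]]]; rewrite leNgt; apply/negP => Ga.
have E0 : E a 0 < 0.
  by rewrite /energy mslope_at0 flow_at0 expr0n/= mul0r add0r.
have u0 : 0 < u a 0 by rewrite flow_at0.
have := trapped (@cu a) (@cp a) (@du a) (@dp a) (lexx 0) E0 u0 (ltW r0).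
by rewrite ltNge (ltW ur).
Qed.

(** k(1+a^2) > 1 gives a^2 > 1/k - 1, and a^2 <= a when a < 1. *)
Let crossing_lower a : crossing a -> Num.min 1 (k^-1 - 1) <= a.
Proof.
move=> ca; have a0 := ca.1.
have := potential_ge0_gt a0 (crossing_potential ca).
rewrite mulrC -ltr_pdivrMr// div1r => h.
have [a1|a1] := leP 1 a; first by rewrite ge_min a1.
rewrite ge_min; apply/orP; right.
have : a ^+ 2 <= a by rewrite expr2 ler_piMr// ltW.
by lra.
Qed.

Lemma critical_height : exists a, [/\ 0 < a, forall r, 0 <= r -> 0 < u a r &
  forall r, 0 <= r -> 0 <= E a r].
Proof.
have C0 : crossing !=set0 by exact: flow_crosses_zero.
have Clb : has_lbound crossing by exists (Num.min 1 (k^-1 - 1)) => a /crossing_lower.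
pose a := inf crossing.
have a0 : 0 < a.
  apply: (@lt_le_trans _ _ (Num.min 1 (k^-1 - 1))).
    by rewrite lt_min ltr01 subr_gt0 invf_gt1.
  by apply: lb_le_inf => // x /crossing_lower.
have u_ge0 r : 0 < r -> 0 <= u a r.
  move=> r0; rewrite leNgt; apply/negP => ur.
  have cN : continuous (fun b => - u b r).
    by apply: continuous_opp; exact: continuous_flow_initial (ltW r0).
  have [|d d0 hd] := continuous_gt0_near (c := a) cN; first by rewrite oppr_gt0.
  (* The bound a/2 keeps the height a - e positive; being a crossing height below the infimum, it is
     absurd. *)
  pose e := Num.min d (a / 2).
  have ed : e <= d by rewrite ge_min lexx.
  have ea : e <= a / 2 by rewrite ge_min lexx orbT.
  have e0 : 0 < e by rewrite lt_min d0 divr_gt0.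
  have : crossing (a - e).
    split; first lra.
    exists r; split=> //; rewrite -oppr_gt0; apply: hd.
    by rewrite addrAC subrr sub0r normrN gtr0_norm.
  by move/(ge_inf Clb); rewrite -/a; lra.
have u_gt0 r : 0 <= r -> 0 < u a r.
  rewrite le_eqVlt => /predU1P[<-|r0]; first by rewrite flow_at0.
  rewrite lt_neqAle u_ge0// andbT; apply/eqP => ur.
  (* A zero of the nonnegative u_a is an interior minimum, so u_a' vanishes there as well and
     uniqueness would give a = 0. *)
  have pr : is_derive r 1 (u a) 0.
    apply: (@derive1_at_min _ _ 0 (r + 1)).
    - by rewrite addr_ge0// ltW.
    - by move=> t; rewrite in_itv/= => /andP[t0 _]; case: (@du a t t0).
    - by rewrite in_itv/= r0 ltrDl ltr01.
    - by move=> t; rewrite in_itv/= => /andP[t0 _]; rewrite -ur; exact: u_ge0.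
  have pr0 : p a r = 0.
    apply/eqP; rewrite -oppr_eq0; apply/eqP.
    by have [_ <-] := du a r0; case: pr.
  have := trivial_of_double_zero k0 k1 (@cu a) (@cp a) (flow_at0 m k01 a)
    (@du a) (@dp a) r0 (esym ur) pr0.
  by move: a0 => /[swap] ->; rewrite ltxx.
exists a; split=> // r r0; rewrite leNgt; apply/negP => Er.
have [|M [M0 hM]] := continuous_pos_min r0 (@cu a).
  by move=> x /andP[x0 _]; exact: u_gt0.
have cE : continuous (fun b => - E b r).
  have ? := continuous_flow_initial r0; have ? := continuous_mslope_initial r0.
  by rewrite /energy /potential; cont => x; exact: one_plus_sqr_gt0.
have [|d d0 hd] := continuous_gt0_near (c := a) cE; first by rewrite oppr_gt0.
(* For |b - a| <= e, d makes the energy of u_b negative at r, and the second bound keeps u_b within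
   M/2 of u_a, hence positive, on [0, r]. So u_b cannot cross before r, nor after r by [trapped]. *)
pose e := Num.min d (M / (4 * expR (2 * r))).
have er : 0 < 4 * expR (2 * r) by rewrite mulr_gt0 ?expR_gt0.
have ed : e <= d by rewrite ge_min lexx.
have eM : e <= M / (4 * expR (2 * r)) by rewrite ge_min lexx orbT.
have e0 : 0 < e by rewrite lt_min d0 divr_gt0.
have [b Cb bae] := inf_adherent e0 (conj C0 Clb).
have ab : a <= b by exact: ge_inf.
have bad : `|b - a| <= e by rewrite ger0_norm ?subr_ge0// lerBlDl ltW.
have Eb : E b r < 0 by rewrite -oppr_gt0; apply: hd; exact: le_trans bad ed.
have ub x : 0 <= x <= r -> 0 < u b x.
  move=> /andP[x0 xr]; have := flow_dist m k01 b a x; rewrite (ger0_norm x0).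
  have : expR (2 * x) <= expR (2 * r) by rewrite ler_expR ler_wpM2l.
  have ex := expR_gt0 (2 * x).
  move: eM; rewrite ler_pdivlMr// => eM exr.
  have : 2 * `|b - a| * expR (2 * x) <= 2 * e * expR (2 * r).
    by apply: ler_pM; rewrite ?mulr_ge0 ?ler_wpM2l ?(ltW ex).
  have := hM x; rewrite x0 xr => /(_ isT).
  by rewrite ler_norml => ? ? /andP[? _]; lra.
have [b0 [s [s0 us]]] := Cb.
have [sr|rs] := leP s r.
  by have := ub s; rewrite (ltW s0) sr => /(_ isT); rewrite ltNge (ltW us).
have : 0 < u b s.
  apply: (trapped (@cu b) (@cp b) (@du b) (@dp b) r0 Eb _ (ltW rs)).
  by apply: ub; rewrite r0 lexx.
by rewrite ltNge (ltW us).
Qed.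

End critical_height.

(** * Square integrability and weak derivatives on the half-line *)

Section sobolev.
Context {R : realType}.
Notation mu := (@lebesgue_measure R).
Implicit Types (f phi F : R -> R) (x K : R).

Lemma half_line_measurable f : (forall x, 0 < x -> {for x, continuous f}) ->
  measurable_fun `](0 : R)%R, +oo[ f.
Proof.
move=> cf; apply: open_continuous_measurable_fun; first exact: interval_open.
by move=> x; rewrite inE/= in_itv/= andbT => /cf.
Qed.

(** phi has finite integral by the fundamental theorem on [0, +oo[, since the nondecreasing bounded
    primitive F has a limit at +oo. *)
Lemma in_L2_dominated f phi F K : 0 <= K ->
  (forall x, 0 < x -> {for x, continuous f}) -> continuous phi ->
  (forall x, 0 <= x -> 0 <= phi x) -> continuous F ->
  (forall x, 0 < x -> is_derive x 1 F (phi x)) ->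
  nondecreasing_fun F -> has_ubound (range F) ->
  (forall x, 0 < x -> f x ^+ 2 <= K * phi x) -> in_L2 `](0 : R)%R, +oo[ f.
Proof.
move=> K0 cf cphi phi0 cF dF ndF ubF fphi.
have mf := half_line_measurable cf.
have mD : measurable (`](0 : R)%R, +oo[ : set R) by exact: measurable_itv.
have phi_fin : (\int[mu]_(x in `[(0 : R)%R, +oo[) (phi x)%:E < +oo)%E.
  rewrite (ge0_continuous_FTC2y phi0 _ (nondecreasing_cvgr ndF ubF)).
  - by rewrite -EFinB ltry.
  - exact: continuous_subspaceT.
  - by move=> x /dF[].
  - exact: cvg_at_right_filter (cF 0).
  - by move=> x; rewrite in_itv/= andbT => /dF[? <-]; rewrite derive1E.
have f2_fin : (\int[mu]_(x in `](0 : R)%R, +oo[) (f x ^+ 2)%R%:E < +oo)%E.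
  apply: (@le_lt_trans _ _ (\int[mu]_(x in `](0 : R)%R, +oo[) (K%:E * (phi x)%:E))%E).
    apply: ge0_le_integral => //.
    - by move=> x _; rewrite lee_fin sqr_ge0.
    - by apply/measurable_EFinP; exact: measurable_funX.
    - apply: emeasurable_funM => //; apply/measurable_EFinP.
      by apply: half_line_measurable => x _; exact: cphi.
    - by move=> x; rewrite /= in_itv/= andbT -EFinM lee_fin => /fphi.
  rewrite ge0_integralZl_EFin//.
  - rewrite lte_mul_pinfty// (le_lt_trans _ phi_fin)//.
    apply: ge0_subset_integral.
    + exact: measurable_itv.
    + exact: measurable_itv.
    + apply/measurable_EFinP; apply: measurable_funTS.
      exact: continuous_measurable_fun.
    + by move=> x; rewrite /= in_itv/= andbT lee_fin => /phi0.
    + by move=> x; rewrite /= !in_itv/= !andbT => /ltW.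
  - by move=> x; rewrite /= in_itv/= andbT lee_fin => /ltW/phi0.
  - apply/measurable_EFinP; apply: half_line_measurable => x _; exact: cphi.
rewrite /in_L2 inE; apply/andP; split; rewrite inE/=.
  exact/(measurable_restrictT _ mD).
rewrite /finite_norm unlock poweR_lty//.
rewrite [X in (X < _)%E](_ : _ = \int[mu]_(x in `](0 : R)%R, +oo[) (f x ^+ 2)%R%:E)%E//.
rewrite [RHS]integral_mkcond; apply: eq_integral => x _.
rewrite [RHS]patchE /= patchE; case: ifPn => _; last by rewrite normr0 powR0.
by rewrite powR_mulrn// real_normK// num_real.
Qed.

(** The test function is supported in some ]a, b[ with a > 0; integration by parts on [a, b] has no
    boundary terms and ignores the behaviour of f at 0. *)
Lemma weak_derivative_half_line f f' :
  (forall x, 0 < x -> is_derive x 1 f (f' x)) ->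
  (forall x, 0 < x -> {for x, continuous f'}) ->
  weak_derivative `](0 : R)%R, +oo[ f f'.
Proof.
move=> df cf' phi [sphi [K [cK KD] phi0]].
have dphi x : derivable phi x 1 by exact: (sphi 0%N).
have cphi : continuous phi.
  by move=> x; apply: differentiable_continuous; apply/derivable1_diffP.
have cphi' : continuous phi^`()%classic.
  move=> x; apply: differentiable_continuous.
  by apply/derivable1_diffP; exact: (sphi 1%N).
have [a [b [a0 ab Kab]]] : exists a b : R, [/\ 0 < a, a < b &
    forall x, K x -> a < x < b].
  have [K0|/set0P K0] := eqVneq K set0.
    by exists 1, 2; split=> // [|x]; rewrite ?K0// ltr1n.
  have cid : {within K, continuous (@idfun R)}.
    by apply: continuous_subspaceT => x; exact: cvg_id.
  have [c cK' hc] := compact_EVT_min K0 cK cid.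
  have [d dK hd] := compact_EVT_max K0 cK cid.
  have c0 : 0 < c by have := KD c (set_mem cK'); rewrite /= in_itv/= andbT.
  have cd := hc d dK.
  exists (c / 2), (d + 1); split; [lra|by move: cd => /=; lra|].
  by move=> x /mem_set Kx; have /= := hc x Kx; have /= := hd x Kx; lra.
have phi_out x : ~ (a < x < b) -> phi x = 0.
  by move=> nx; apply: phi0 => /Kab.
have dphi_out x : ~ (a <= x <= b) -> phi^`()%classic x = 0.
  move=> nx; rewrite derive1E.
  have dphi0 : is_derive x 1 phi 0.
    have : \forall y \near x, 0 = phi y.
      have [xa|ax] := ltP x a.
        near=> y; rewrite phi_out// => /andP[+ _]; apply/negP; rewrite -leNgt ltW//.
        by near: y; exact: lt_nbhsl.
      have bx : b < x by rewrite ltNge; apply/negP => xb; apply: nx; rewrite ax.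
      near=> y; rewrite phi_out// => /andP[_]; apply/negP; rewrite -leNgt ltW//.
      by near: y; exact: lt_nbhsr.
    by move/(@is_derive_near _ (fun=> 0)); apply; exact: is_derive_cstE.
  by case: dphi0.
have to_ab (g : R -> R) : (forall x, ~ (a <= x <= b) -> g x = 0) ->
    \int[mu]_(x in `](0 : R)%R, +oo[) g x = \int[mu]_(x in `[a, b]) g x.
  move=> g0; rewrite Rintegral_mkcond [RHS]Rintegral_mkcond; congr Rintegral.
  apply/funext => x; rewrite !patchE !mem_setE !in_itv/= andbT.
  case: (ltP 0 x) => x0; case: (boolP (a <= x <= b)) => xab //.
    by rewrite g0//; exact/negP.
  by move: xab => /andP[/(lt_le_trans a0)]; rewrite ltNge x0.
have cf x : 0 < x -> {for x, continuous f}.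
  by move=> x0; exact: is_derive_continuous (df x x0).
have within_ab (g : R -> R) : (forall x, 0 < x -> {for x, continuous g}) ->
    {within `[a, b], continuous g}.
  move=> cg; apply/subspace_continuousP => x; rewrite /= in_itv/= => /andP[ax _].
  by apply: cvg_within_filter; apply: cg; exact: lt_le_trans ax.
have LR (g : R -> R) : (forall x, 0 < x -> derivable g x 1) ->
    derivable_oo_LRcontinuous g a b.
  move=> dg; have cg x : 0 < x -> {for x, continuous g}.
    by move=> x0; apply: differentiable_continuous; apply/derivable1_diffP; exact: dg.
  split.
  - by move=> x; rewrite in_itv/= => /andP[ax _]; apply: dg; exact: lt_trans ax.
  - by apply: cvg_at_right_filter; exact: cg.
  - by apply: cvg_at_left_filter; apply: cg; exact: lt_trans ab.
rewrite !to_ab; last 2 first.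
- by move=> x nx; rewrite phi_out ?mulr0// => /andP[ax xb]; apply: nx; rewrite !ltW.
- by move=> x nx; rewrite dphi_out// mulr0.
rewrite (@Rintegration_by_parts _ f phi f' phi^`()%classic a b).
- by rewrite !phi_out ?mulr0 ?subrr ?sub0r// ?ltxx ?andbF.
- exact: ab.
- exact: within_ab.
- by apply: LR => x /df[].
- move=> x; rewrite in_itv/= => /andP[ax _].
  by have [_ <-] := df x (lt_trans a0 ax); rewrite derive1E.
- exact: continuous_subspaceT.
- by apply: LR => x _.
- by [].
Unshelve. all: by end_near. Qed.

End sobolev.

(** * The ground state *)

Section ground_state.
Context {R : realType} (m : nat) (k a : R).
Hypotheses (k0 : 0 < k) (k1 : k < 1) (k01 : 0 <= k <= 1).

Local Notation u := (flow m k01 a).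
Local Notation p := (mslope m k01 a).
Local Notation g := (nonlin k).

Hypotheses (a0 : 0 < a) (u_gt0 : forall r : R, 0 <= r -> 0 < u r)
  (E_ge0 : forall r : R, 0 <= r -> 0 <= energy k u p r).
Implicit Types (r x y : R).

Let cu : continuous u. Proof. exact: continuous_flow. Qed.
Let cp : continuous p. Proof. exact: continuous_mslope. Qed.
Let du r : 0 < r -> is_derive r 1 u (- p r).
Proof. exact: is_derive_flow. Qed.
Let dp r : 0 < r -> is_derive r 1 p (g (u r) - m%:R / r * p r).
Proof. exact: is_derive_mslope. Qed.
Let u0 : u 0 = a. Proof. exact: flow_at0. Qed.
Let p0 : p 0 = 0. Proof. exact: mslope_at0. Qed.
Let cdp x : 0 < x -> {for x, continuous (fun x => - (g (u x) - m%:R / x * p x))}.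
Proof.
move=> x0; apply: cvgN; apply: cvgB; first exact: continuous_nonlin.
apply: cvgM; last exact: cp.
apply: cvgM; first exact: cvg_cst.
by apply: cvgV; [rewrite gt_eqF|exact: cvg_id].
Qed.

Let p_gt0 r : 0 < r -> 0 < p r.
Proof. exact: (slope_gt0 cu cp p0 dp u_gt0 E_ge0). Qed.

Let u_decr r x : 0 <= r -> r <= x -> u x <= u r.
Proof. exact: (trajectory_decreasing cu cp p0 du dp u_gt0 E_ge0). Qed.

Let p_ge0 r : 0 <= r -> 0 <= p r.
Proof. by rewrite le_eqVlt => /predU1P[<-|/p_gt0/ltW//]; rewrite p0. Qed.

(** p is integrable since -u is bounded, but it vanishes at 0; exp(- x) keeps phi away from 0 on
    bounded intervals. F is a primitive of phi on r > 0. *)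
Let phi x := p x + expR (- x).
Let F x := - u x - expR (- x).

Let flow_neg x : x <= 0 -> u x = a.
Proof. by move=> x0; rewrite flowE pot_le0// subr0. Qed.

Let F_nondecreasing : nondecreasing_fun F.
Proof.
move=> x y xy; rewrite /F lerB//; last by rewrite ler_expR lerN2.
rewrite lerN2; have [x0|x0] := leP 0 x; first exact: u_decr.
rewrite (flow_neg (ltW x0)); have [y0|y0] := leP y 0; first by rewrite flow_neg.
by have := u_decr (lexx 0) (ltW y0); rewrite u0.
Qed.

Let F_ubound : has_ubound (range F).
Proof.
exists 0 => _ [x _ <-]; rewrite /F -opprD oppr_le0 addr_ge0 ?expR_ge0//.
have [x0|/ltW x0] := leP 0 x; first exact/ltW/u_gt0.
by rewrite flow_neg// ltW.
Qed.

Let L2_of_bound (f : R -> R) (K : R) : 0 <= K ->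
  (forall x, 0 < x -> {for x, continuous f}) ->
  (forall x, 0 < x -> f x ^+ 2 <= K * phi x) -> in_L2 `]0, +oo[ f.
Proof.
move=> K0 cf fK; apply: (@in_L2_dominated _ f phi F K) => //.
- by rewrite /phi; cont.
- by move=> x x0; rewrite addr_ge0 ?expR_ge0 ?p_ge0.
- by rewrite /F; cont.
- by move=> x x0; have ? := du x0; rewrite /F; deriv_eq; rewrite /phi; ring.
Qed.

Lemma ground_state_bounds : exists K, 0 <= K /\ forall x, 0 < x ->
  [/\ u x ^+ 2 <= K * phi x, p x ^+ 2 <= K * phi x &
      (g (u x) - m%:R / x * p x) ^+ 2 <= K * phi x].
Proof.
have [r [c [r0 c0 hc]]] := trajectory_le_slope k0 k1 cu cp u0 p0 du dp a0 u_gt0 E_ge0.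
have [M M0 hM] := slope_le_linear cu cp p0 dp 1.
pose S := 2 * energy k u p 0 + a ^+ 2.
have S0 : 0 <= S by rewrite addr_ge0 ?sqr_ge0// mulr_ge0// E_ge0.
(* The first term serves from r on, where u <= p/c; the second before r, where exp(r) phi >= 1. *)
pose K1 := a / c + a ^+ 2 * expR r.
(* p^2 <= S gives p <= S + 1, and the other factor p is at most phi. *)
pose K2 := S + 1.
have K10 : 0 <= K1.
  by rewrite addr_ge0 ?mulr_ge0 ?sqr_ge0 ?expR_ge0 ?invr_ge0 ?(ltW a0) ?(ltW c0).
have K20 : 0 <= K2 by rewrite addr_ge0.
(* For (p/x)^2: the first term covers x <= 1, where p/x <= M, and K2 covers x >= 1, where p/x <=
   p. *)
pose K3 := M ^+ 2 * expR 1 + K2.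
have K30 : 0 <= K3 by rewrite addr_ge0// mulr_ge0 ?sqr_ge0 ?expR_ge0.
have phip x : p x <= phi x by rewrite lerDl expR_ge0.
have phie x y : 0 < x -> x <= y -> 1 <= expR y * phi x.
  move=> x0 xy; have -> : 1 = expR y * expR (- y) :> R.
    by rewrite -expRD subrr expR0.
  apply: ler_wpM2l; first exact: expR_ge0.
  by rewrite /phi ler_wpDl ?p_ge0 ?(ltW x0)// ler_expR lerN2.
have phi0 x : 0 < x -> 0 < phi x by move=> x0; rewrite addr_gt0 ?p_gt0 ?expR_gt0.
have bu x : 0 < x -> u x ^+ 2 <= K1 * phi x.
  move=> x0; have ua : u x <= a by have := u_decr (lexx 0) (ltW x0); rewrite u0.
  have ux := u_gt0 (ltW x0); have phx := phi0 x x0.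
  have [rx|xr] := leP r x.
    have : u x ^+ 2 <= a * u x by rewrite expr2 ler_pM2r.
    have : a * u x <= a / c * phi x.
      rewrite -mulrA ler_pM2l// mulrC ler_pdivlMr// mulrC.
      by apply: le_trans (hc x rx) (phip x).
    have : 0 <= a ^+ 2 * expR r * phi x.
      apply: mulr_ge0 (ltW phx); apply: mulr_ge0; [exact: sqr_ge0|exact: expR_ge0].
    by rewrite /K1 mulrDl; lra.
  have : u x ^+ 2 <= a ^+ 2 by rewrite ler_sqr ?nnegrE ?(ltW ux) ?(ltW a0).
  have : a ^+ 2 * 1 <= a ^+ 2 * (expR r * phi x).
    by apply: ler_wpM2l (phie x r x0 (ltW xr)); exact: sqr_ge0.
  have : 0 <= a / c * phi x.
    by apply: mulr_ge0 (ltW phx); rewrite divr_ge0 ?(ltW a0) ?(ltW c0).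
  by rewrite /K1 mulrDl mulrA mulr1; lra.
have bp x : 0 < x -> p x ^+ 2 <= K2 * phi x.
  move=> x0; have px := p_gt0 x0.
  have hS := slope_sqr_le k0 cu cp u0 p0 du dp a0 u_gt0 E_ge0 (ltW x0).
  rewrite expr2; apply: ler_pM; rewrite ?(ltW px)//.
  by rewrite /K2 /S; have := sqr_ge0 (p x - 1); have := sqr_ge0 (p x); lra.
have bq x : 0 < x -> (p x / x) ^+ 2 <= K3 * phi x.
  move=> x0; have px := p_gt0 x0; have phx := phi0 x x0.
  have q0 : 0 <= p x / x by rewrite divr_ge0// ltW.
  have M2 : 0 <= M ^+ 2 * expR 1 * phi x.
    apply: mulr_ge0 (ltW phx); apply: mulr_ge0; [exact: sqr_ge0|exact: expR_ge0].
  have [x1|/ltW x1] := leP 1 x.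
    have : (p x / x) ^+ 2 <= p x ^+ 2.
      by rewrite ler_sqr ?nnegrE ?(ltW px)// ler_pdivrMr// ler_peMr// ltW.
    by move=> h; rewrite /K3 mulrDl ler_wpDl// (le_trans h)// bp.
  have : (p x / x) ^+ 2 <= M ^+ 2.
    have hMx : p x <= M * x by apply: hM; rewrite (ltW x0).
    by rewrite ler_sqr ?nnegrE ?(ltW M0)// ler_pdivrMr.
  have : M ^+ 2 * 1 <= M ^+ 2 * (expR 1 * phi x).
    by apply: ler_wpM2l (phie x 1 x0 x1); exact: sqr_ge0.
  have : 0 <= K2 * phi x by rewrite mulr_ge0// ltW.
  move=> h3 h2 h1; rewrite /K3 mulrDl ler_wpDr// (le_trans h1)//.
  by rewrite -[leLHS]mulr1 -[leRHS]mulrA.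
(* With q = p/x, (g - m q)^2 <= 2 g^2 + 2 m^2 q^2 and g^2 <= 4 u^2; K2 is there for p^2. *)
exists (8 * K1 + 2 * m%:R ^+ 2 * K3 + K2); split.
  apply: addr_ge0 K20; apply: addr_ge0; first exact: mulr_ge0.
  by apply: mulr_ge0 K30; apply: mulr_ge0 => //; exact: sqr_ge0.
move=> x x0; have := bu x x0; have := bp x x0; have := bq x x0.
have phx := phi0 x x0.
have A1 : 0 <= K1 * phi x by rewrite mulr_ge0// ltW.
have A2 : 0 <= K2 * phi x by rewrite mulr_ge0// ltW.
have A3 : 0 <= m%:R ^+ 2 * (K3 * phi x).
  by rewrite mulr_ge0 ?sqr_ge0// mulr_ge0// ltW.
have -> : (8 * K1 + 2 * m%:R ^+ 2 * K3 + K2) * phi x =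
  8 * (K1 * phi x) + 2 * (m%:R ^+ 2 * (K3 * phi x)) + K2 * phi x by ring.
move=> hq hp hu; split; [lra|lra|].
have mq : m%:R ^+ 2 * (p x / x) ^+ 2 <= m%:R ^+ 2 * (K3 * phi x).
  by apply: ler_wpM2l hq; exact: sqr_ge0.
have gu : g (u x) ^+ 2 <= 4 * u x ^+ 2.
  have -> : 4 * u x ^+ 2 = (2 * u x) ^+ 2 by ring.
  have := norm_nonlin_le k0 k1 (u x); rewrite (gtr0_norm (u_gt0 (ltW x0))) => h.
  rewrite -[g (u x) ^+ 2]real_normK ?num_real// ler_sqr ?nnegrE//.
  by rewrite mulr_ge0// ltW// u_gt0// ltW.
have -> : m%:R / x * p x = m%:R * (p x / x) by rewrite mulrAC mulrA.
rewrite -exprMn in mq; have := sqr_ge0 (g (u x) + m%:R * (p x / x)).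
have -> : (g (u x) - m%:R * (p x / x)) ^+ 2 = 2 * g (u x) ^+ 2 +
  2 * (m%:R * (p x / x)) ^+ 2 - (g (u x) + m%:R * (p x / x)) ^+ 2 by ring.
move: gu mq hu A2 A3; clear.
move: (g (u x) ^+ 2) ((m%:R * (p x / x)) ^+ 2) (u x ^+ 2) (K1 * phi x) (K2 * phi x)
  (m%:R ^+ 2 * (K3 * phi x)) ((g (u x) + m%:R * (p x / x)) ^+ 2).
by move=> *; lra.
Qed.

Lemma ground_state_in_H2 : in_H2 `]0, +oo[ u.
Proof.
have [K [K0 hK]] := ground_state_bounds.
exists (fun x => - p x), (fun x => - (g (u x) - m%:R / x * p x)); split.
- by apply: (L2_of_bound K0) => x x0; [exact: cu|have [] := hK x x0].
- apply: (L2_of_bound K0) => x x0; last by rewrite sqrrN; have [] := hK x x0.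
  by apply: cvgN; exact: cp.
- apply: (L2_of_bound K0) => x x0; last by rewrite sqrrN; have [] := hK x x0.
  exact: cdp.
- apply: weak_derivative_half_line => x x0; first exact: du.
  by apply: cvgN; exact: cp.
- apply: weak_derivative_half_line => x x0; last exact: cdp.
  by have ? := dp x0; deriv.
Qed.

Lemma flow_derive1 r : 0 < r -> u^`()%classic r = - p r.
Proof. by move=> r0; have [_ <-] := du r0; rewrite derive1E. Qed.

Lemma is_derive_flow_derive1 r : 0 < r ->
  is_derive r 1 u^`()%classic (- (g (u r) - m%:R / r * p r)).
Proof.
move=> r0; have : \forall y \near r, - p y = u^`()%classic y.
  by near=> y; rewrite flow_derive1//; near: y; exact: lt_nbhsr.
move/(@is_derive_near _ (fun y => - p y)); apply.
by have ? := dp r0; deriv.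
Unshelve. all: by end_near. Qed.

Lemma ground_state_solution : radial_saturated_nls_solution m.+1 (1 - k) u.
Proof.
split.
- by move=> r r0; have [? _] := du r0; have [? _] := is_derive_flow_derive1 r0.
- move=> r r0; have [_ h2] := is_derive_flow_derive1 r0.
  rewrite flow_derive1// -natr1 addrK.
  have -> : u^`(2)%classic r = - (g (u r) - m%:R / r * p r).
    by rewrite -h2 -derive1E.
  have rn0 : r != 0 by rewrite gt_eqF.
  move: (one_plus_sqr_neq0 (u r)); rewrite /nonlin; move: (u r) (p r) => v q vn.
  by field; apply/andP.
- exact: ground_state_in_H2.
- have cNp : - p r @[r --> 0] --> (0 : R).
    by rewrite -[X in _ --> X]oppr0 -[in X in _ --> X]p0; exact: (continuous_opp cp).
  apply: cvg_trans (cvg_at_right_filter cNp); apply: near_eq_cvg.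
  near=> r; rewrite flow_derive1//; near: r; exact: nbhs_right_gt.
Unshelve. all: by end_near. Qed.

End ground_state.

Theorem theorem7 (R : realType) (d : nat) (omega : R)
    (hd : (1 <= d)%N) (homega0 : 0 < omega) (homega1 : omega < 1) :
  exists u : R -> R,
    radial_saturated_nls_solution d omega u /\
    (forall r : R, 0 < r -> 0 < u r).
Proof.
case: d hd => // m _.
have k0 : 0 < 1 - omega by rewrite subr_gt0.
have k1 : 1 - omega < 1 by rewrite gtrBl.
have k01 : 0 <= 1 - omega <= 1 by rewrite !ltW.
have [a [a0 u_gt0 E_ge0]] := critical_height m k0 k1 k01.
exists (flow m k01 a); split; last by move=> r /ltW/u_gt0.
have := ground_state_solution k0 k1 a0 u_gt0 E_ge0.
by rewrite subKr.
Qed.
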